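(* Suppose $n=\dim V$ is even, and $\langle\cdot,\cdot\rangle$ is skew-symmetric. For a given $r\ge 1$, the maximal dimension of $Z(l,d,r;V)$, as $(l,d)$ ranges over integers with $1\le d\le n/2$ and $0\le l\le d$, is attained by and only by \begin{enumerate} \item $\dim Z(2,2,r;V)=12r+3$ when $n=4$; \item $\dim Z(3,3,r;V)=27r+6$ when $n=6$; \item $\dim Z(4,4,1;V)=\dim Z(1,1,1;V)=58$ when $n=8$ and $r=1$; \item $\dim Z(1,1,r;V)=(n-1)^2r+2r+n-1$ in all other cases. \end{enumerate}
   Context: $k$ is an algebraically closed field of characteristic different from $2$; $n,r$ are positive integers; $V=k^n$ is equipped with a nondegenerate bilinear form $\langle\cdot,\cdot\rangle$ (here skew-symmetric). $\rho$ is the adjoint involution on $\mathrm{End}_k(V)$, determined by $\langle\rho(A)v,w\rangle=\langle v,Aw\rangle$ for all $v,w\in V$. For a subspace $W\subseteq V$, $W^\perp=\{x\in V\mid \langle w,x\rangle=0\ \forall w\in W\}$ and the isotropy rank of $W$ is $\dim_k(W\cap W^\perp)$. For $A_\bullet=(A_1,\dots,A_r)\in\mathrm{End}_k(V)^r$, $W$ is $\rho$-invariant under $A_\bullet$ if $A_iW\subseteq W$ and $\rho(A_i)W\subseteq W$ for all $i$. $Z(\ge l,d,r;V)$ is the set of $A_\bullet\in\mathrm{End}_k(V)^r$ having some $\rho$-invariant subspace of dimension $d$ and isotropy rank at least $l$; it is Zariski closed. $Z(l,d,r;V)=Z(\ge l,d,r;V)\setminus Z(\ge l+1,d,r;V)$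 (possibly empty; the empty set is not counted as attaining a maximum). The dimension of a (possibly reducible) variety is the maximum of the dimensions of its irreducible components. *)

(* Defs.v *)
From HB Require Import structures.
From mathcomp Require Import all_boot all_order all_algebra.
From mathcomp Require Import mpoly.

Set Implicit Arguments.
Unset Strict Implicit.
Unset Printing Implicit Defensive.

Import GRing.Theory.
Local Open Scope ring_scope.

(** * Zariski topology and dimension in affine space [k^N] *)

Section AffineSpace.
Variables (k : fieldType) (N : nat).
Implicit Types (X Y S C : 'rV[k]_N -> Prop) (p q : {mpoly k[N]}).

Definition peval p (x : 'rV[k]_N) : k := p.@[fun i => x 0 i].

Definition incl X Y := forall x, X x -> Y x.

Definition zariski_closed C :=
  exists F : {mpoly k[N]} -> Prop,
    forall x, C x <-> (forall p, F p -> peval p x = 0).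

(* Irreducibility for the subspace topology: the closed subsets of [Y] are
   the traces on [Y] of the closed subsets of [k^N]. *)
Definition irreducible Y :=
  (exists x, Y x) /\
  forall C1 C2, zariski_closed C1 -> zariski_closed C2 ->
    incl Y (fun x => C1 x \/ C2 x) -> incl Y C1 \/ incl Y C2.

Definition irreducible_component S Y :=
  [/\ irreducible Y, incl Y S &
      forall Y', irreducible Y' -> incl Y Y' -> incl Y' S -> incl Y' Y].

(* For [Y] irreducible and locally closed, the elements of the function field
   [k(Y)] are the fractions [f / g] of polynomials with [g] not vanishing
   identically on [Y]; such an element is zero iff it vanishes at the points
   of [Y] where it is defined, or just on some nonempty open subset of [Y].
   So the following says that [f_0 / g_0], ..., [f_(d-1) / g_(d-1)] are
   elements of [k(Y)] that are algebraically independent over [k]. *)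
Definition alg_independent_on Y d (f g : 'I_d -> {mpoly k[N]}) :=
  (forall i, exists2 x, Y x & peval (g i) x != 0) /\
  forall P : {mpoly k[d]},
    (forall x, Y x -> (forall i, peval (g i) x != 0) ->
       P.@[fun i => peval (f i) x / peval (g i) x] = 0) ->
    P = 0.

(* [tr.deg_k k(Y) = d] *)
Definition function_field_trdeg Y d :=
  (exists f g, alg_independent_on Y (d := d) f g) /\
  forall d' f g, alg_independent_on Y (d := d') f g -> (d' <= d)%N.

(* The dimension of an irreducible variety is the transcendence degree of its
   function field; in general, it is the maximum over the irreducible
   components. The empty set has no dimension. *)
Definition has_dim S m :=
  (exists2 Y, irreducible_component S Y & function_field_trdeg Y m) /\
  forall Y m', irreducible_component S Y -> function_field_trdeg Y m' ->
    (m' <= m)%N.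

End AffineSpace.

(** * Adjoints and rho-invariant subspaces *)

Section Invariant.
Variables (k : fieldType) (n : nat) (B : {skew_symmetric 'cV[k]_n}).

Definition gram : 'M[k]_n := \matrix_(i, j) B (delta_mx i 0) (delta_mx j 0).

Lemma gramE v w : B v w = (v^T *m gram *m w) 0 0.
Proof.
have cV_sum (u : 'cV[k]_n) : u = \sum_i u i 0 *: delta_mx i 0.
  by rewrite {1}[u]matrix_sum_delta; apply: eq_bigr => i _; rewrite big_ord1.
rewrite {1}[v]cV_sum {1}[w]cV_sum linear_sumr mxE; apply: eq_bigr => j _.
rewrite linearZr_LR /= linear_sumlz mxE mulrC; congr (_ * _).
by apply: eq_bigr => i _; rewrite linearZl_LR !mxE.
Qed.

Definition rho (A : 'M[k]_n) : 'M[k]_n := (gram *m A *m invmx gram)^T.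

Lemma gram_unit : nondegenerate B -> gram \in unitmx.
Proof.
move=> /eqP B_nd; rewrite -row_free_unit -kermx_eq0.
apply/eqP/row_matrixP => i; rewrite row0; apply: trmx_inj; rewrite trmx0.
apply/eqP; rewrite -memv0 -B_nd; apply/mem_orthovP => w _.
by rewrite gramE trmxK -row_mul mulmx_ker row0 mul0mx mxE.
Qed.

Lemma rhoP : nondegenerate B ->
  forall A v w, B (rho A *m v) w = B v (A *m w).
Proof.
move=> /gram_unit uG A v w; rewrite !gramE trmx_mul trmxK.
by rewrite !mulmxA mulmxKV.
Qed.

Lemma rho_unique : nondegenerate B ->
  forall A A', (forall v w, B (A' *m v) w = B v (A *m w)) -> A' = rho A.
Proof.
move=> B_nd A A' A'P; apply/matrixP => i j; apply/eqP; rewrite -subr_eq0.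
have /eqP nd := B_nd.
have : (A' - rho A) *m delta_mx j 0 \in orthov B fullv.
  by apply/mem_orthovP => w _; rewrite mulmxBl linearBl /= A'P rhoP ?subrr.
by rewrite nd memv0 -colE => /eqP/matrixP/(_ i 0); rewrite !mxE => ->.
Qed.

Definition stable (W : {vspace 'cV[k]_n}) (A : 'M[k]_n) :=
  forall w, w \in W -> A *m w \in W.

Definition rho_invariant r (A : 'I_r -> 'M[k]_n) (W : {vspace 'cV[k]_n}) :=
  forall i, stable W (A i) /\ stable W (rho (A i)).

(* [orthov] uses [B x w = 0] where the usual right orthogonal has [B w x = 0];
   the two agree as [B] is skew-symmetric. *)
Definition isotropy_rank (W : {vspace 'cV[k]_n}) : nat :=
  \dim (W :&: orthov B W)%VS.

Definition Zge l d r (A : 'I_r -> 'M[k]_n) :=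
  exists W : {vspace 'cV[k]_n},
    [/\ rho_invariant A W, \dim W = d & (l <= isotropy_rank W)%N].

Definition Zeq l d r (A : 'I_r -> 'M[k]_n) := Zge l d A /\ ~ Zge l.+1 d A.

(* [End(V)^r] as the affine space [k^(r n^2)] of matrix entries. *)
Definition endo_tuple r (x : 'rV[k]_(r * (n * n))) : 'I_r -> 'M[k]_n :=
  fun i => vec_mx (row i (vec_mx x)).

Definition dimZ l d r m := has_dim (fun x => Zeq l d (@endo_tuple r x)) m.

Definition in_range l d := [/\ (1 <= d)%N, (d <= n./2)%N & (l <= d)%N].

(* The maximal dimension is [m], and it is attained at [(l, d)]. *)
Definition max_dimZ_at r l d m :=
  [/\ in_range l d, dimZ l d r m &
      forall l' d' m', in_range l' d' -> dimZ l' d' r m' -> (m' <= m)%N].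

End Invariant.

(* Main.v *)
Require Import Defs.
From mathcomp Require Import all_boot all_order all_algebra all_fingroup.
From mathcomp Require Import mpoly zify ring.
From Stdlib Require Classical_Prop.

(** The set [Z(l, d)] fibres over the subspaces [W] of dimension [d] and isotropy
    rank [l]: the tuples that leave [W] invariant form a vector space, and
    counting parameters gives, with [a := d - l] and [b := n - l - d],

      E(l, a) = r (2 l n - l^2 + a^2 + b^2) + l (n - 2 l) + l (l + 1) / 2 + a b.

    The theorem follows from three facts: every [Z(l, d)] has dimension at most
    [E(l, d - l)]; the sets [Z(l, l)] with [1 <= l <= n / 2] have dimension
    exactly [E(l, 0)]; and the largest value of [E] is the one stated, taken
    only for [d = l], where [l] is [1], or [n / 2] if [n] is [4], [6] or [8].

    Upper bound.  Let [U] be the intersection of [W] and [W^perp].  In a fixed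
    hyperbolic frame [E, K, F] of [V], if [U] is transverse to [<K, F>], it is the
    span of [E + K Y + F Z], where [Y] is free and [Z] is determined by [Y] up to
    a symmetric matrix.  Writing [A = b G], with [G] the Gram matrix,
    turns the endomorphisms that preserve [W] and [W^perp] into the tensors
    [b] in [U V + V U + W W + W^perp W^perp]; so all tuples with such a [W] are
    values of finitely many polynomial maps on an affine space of dimension
    [E(l, a)] ([invariant_normal_form], [nondegenerate_chart]).  A general [W]
    is moved into transverse position by a product of transvections
    ([general_position]); scaling the transvections by [s] and letting [s] tend
    to [0] shows that the values of these maps are dense ([general_position_dense]).
    A set in the closure of such images has at most [E(l, a)] algebraically
    independent functions, since a space of polynomials of bounded degree is
    too small to hold all their monomials ([alg_independent_on_leq]).

    Lower bound.  For [a = 0] a single polynomial map suffices, and its image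
    is a dense subset of [Z(l, l)]; so [Z(l, l)] is irreducible
    ([Zeq_irreducible]).  The derivative of the map is injective at the tuple whose
    first member is the projection onto [<E>] along [<K, F>] and whose other
    members vanish: some linear forms [f_u], one for each parameter [u], satisfy
    [f_u (phi (t0 + s y)) = c_u + s y_u + O(s^2)] ([line_expand],
    [line_derivative_coord]).  A polynomial relation between the [f_u] would have
    a lowest-degree form vanishing at every [y], so there is none
    ([alg_independent_on_lines]). *)

Set Implicit Arguments.
Unset Strict Implicit.
Unset Printing Implicit Defensive.

Import GRing.Theory.
Local Open Scope ring_scope.

(** * Polynomials as functions *)

Section ZeroFunction.
Variable k : closedFieldType.

Lemma poly_fun_eq0 (q : {poly k}) : (forall s, q.[s] = 0) -> q = 0.
Proof.
move=> q0; apply/eqP; apply: contraT => /closed_nonrootP[x].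
by rewrite /root q0 eqxx.
Qed.

Lemma digits_inj n b (f g : 'I_n -> nat) :
    (forall i, f i < b)%N -> (forall i, g i < b)%N ->
  (\sum_i f i * b ^ i = \sum_i g i * b ^ i)%N -> f =1 g.
Proof.
elim: n f g => [|n IHn] f g fb gb; first by move=> _ [].
have b_gt0 : (0 < b)%N by apply: leq_ltn_trans (fb ord0).
have shift (h : 'I_n.+1 -> nat) : (\sum_i h i * b ^ i =
    h ord0 + b * \sum_(i < n) h (lift ord0 i) * b ^ i)%N.
  rewrite big_ord_recl muln1 big_distrr /=; congr (_ + _)%N.
  by apply: eq_bigr => i _; rewrite expnS mulnCA.
rewrite !shift => e.
have e0 : f ord0 = g ord0.
  have := congr1 (modn^~ b) e.
  by rewrite /= ![(_ + b * _)%N]addnC ![(b * _)%N]mulnC !modnMDl !modn_small.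
have eS : (fun i => f (lift ord0 i)) =1 (fun i => g (lift ord0 i)).
  apply: IHn => [i|i|]; [exact: fb | exact: gb |].
  by move: e; rewrite e0 => /addnI /eqP; rewrite eqn_pmul2l // => /eqP.
by move=> i; case: (unliftP ord0 i) => [j|] ->; [exact: eS | exact: e0].
Qed.

(** Kronecker substitution: for [x_i := x ^ (b ^ i)], with [b] larger than all
    exponents, distinct monomials become distinct powers of [x]. *)
Lemma mpoly_fun_eq0 n (p : {mpoly k[n]}) : (forall v, p.@[v] = 0) -> p = 0.
Proof.
move=> p0; set b := msize p.
pose code (m : 'X_{1..n}) := (\sum_i m i * b ^ i)%N.
have supp_lt m : m \in msupp p -> forall i, (m i < b)%N.
  move=> /msize_mdeg_lt mb i; apply: leq_ltn_trans mb.
  by rewrite mdegE (bigD1 i) //= leq_addr.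
have code_inj : {in msupp p &, injective code}.
  move=> m1 m2 m1p m2p e; apply/mnmP.
  by apply: (digits_inj (supp_lt _ m1p) (supp_lt _ m2p)).
pose q := \sum_(m <- msupp p) p@_m *: 'X^(code m).
have q0 : q = 0.
  apply: poly_fun_eq0 => x; rewrite -[RHS](p0 (fun i : 'I_n => x ^+ (b ^ i)%N)).
  rewrite mevalE horner_sum; apply: eq_bigr => m _.
  rewrite hornerZ hornerXn -prodrXr; congr (_ * _); apply: eq_bigr => i _.
  by rewrite -exprM mulnC.
apply/mpolyP => m; rewrite mcoeff0; apply/eqP; apply: contraT.
rewrite -mcoeff_msupp => mp; have := congr1 (fun r : {poly k} => r`_(code m)) q0.
rewrite coef_sum coef0 (bigD1_seq m) ?msupp_uniq //= coefZ coefXn eqxx mulr1.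
rewrite big_seq_cond big1 ?addr0 => [/eqP|m' /andP[m'p m'm]].
  by rewrite mcoeff_eq0 mp.
rewrite coefZ coefXn; case: eqP => [e|_]; last by rewrite mulr0.
by rewrite (code_inj _ _ mp m'p e) eqxx in m'm.
Qed.

End ZeroFunction.

Section PolynomialFunctions.
Variables (k : fieldType) (I : finType) (X : Type) (c : X -> I -> k).
Implicit Types (h : X -> k).

(** [h] is a polynomial in the coordinate functions [c].  One notion serves
    the functions on a parameter space and, with one coordinate, those on a
    line. *)
Definition polyfn h :=
  exists p : {mpoly k[#|I|]}, forall x, h x = p.@[fun i => c x (enum_val i)].

Lemma polyfn_ext h1 h2 : h1 =1 h2 -> polyfn h1 -> polyfn h2.
Proof. by move=> e [p hp]; exists p => x; rewrite -e. Qed.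

Lemma polyfn_const a : polyfn (fun=> a).
Proof. by exists a%:MP => x; rewrite mevalC. Qed.

Lemma polyfn_coord i : polyfn (fun x => c x i).
Proof. by exists 'X_(enum_rank i) => x; rewrite mevalXU enum_rankK. Qed.

Lemma polyfnD h1 h2 : polyfn h1 -> polyfn h2 -> polyfn (fun x => h1 x + h2 x).
Proof. by move=> [p hp] [q hq]; exists (p + q) => x; rewrite hp hq mevalD. Qed.

Lemma polyfnM h1 h2 : polyfn h1 -> polyfn h2 -> polyfn (fun x => h1 x * h2 x).
Proof. by move=> [p hp] [q hq]; exists (p * q) => x; rewrite hp hq mevalM. Qed.

Lemma polyfnN h : polyfn h -> polyfn (fun x => - h x).
Proof. by move=> [p hp]; exists (- p) => x; rewrite hp mevalN. Qed.

Lemma polyfn_sum (T : Type) (r : seq T) (P : pred T) (h : T -> X -> k) :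
  (forall i, P i -> polyfn (h i)) -> polyfn (fun x => \sum_(i <- r | P i) h i x).
Proof.
move=> hP; elim: r => [|i r IHr].
  by apply: polyfn_ext (polyfn_const 0) => x; rewrite big_nil.
case Pi: (P i).
  apply: polyfn_ext (polyfnD (hP i Pi) IHr) => x; by rewrite big_cons Pi.
by apply: polyfn_ext IHr => x; rewrite big_cons Pi.
Qed.

Lemma polyfn_prod (T : Type) (r : seq T) (P : pred T) (h : T -> X -> k) :
  (forall i, P i -> polyfn (h i)) -> polyfn (fun x => \prod_(i <- r | P i) h i x).
Proof.
move=> hP; elim: r => [|i r IHr].
  by apply: polyfn_ext (polyfn_const 1) => x; rewrite big_nil.
case Pi: (P i).
  apply: polyfn_ext (polyfnM (hP i Pi) IHr) => x; by rewrite big_cons Pi.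
by apply: polyfn_ext IHr => x; rewrite big_cons Pi.
Qed.

Lemma polyfn_meval N (q : {mpoly k[N]}) (F : X -> 'I_N -> k) :
  (forall i, polyfn (fun x => F x i)) -> polyfn (fun x => q.@[F x]).
Proof.
move=> hF; apply: (@polyfn_ext (fun x => \sum_(m <- msupp q)
    q@_m * \prod_i \prod_(j < m i) F x i)).
  move=> x; rewrite mevalE; apply: eq_bigr => m _; congr (_ * _).
  by apply: eq_bigr => i _; rewrite prodr_const card_ord.
apply: polyfn_sum => m _; apply: polyfnM; first exact: polyfn_const.
by apply: polyfn_prod => i _; apply: polyfn_prod => j _; exact: hF.
Qed.

Definition polymx a b (A : X -> 'M[k]_(a, b)) :=
  forall i j, polyfn (fun x => A x i j).

Lemma polymx_const a b (A : 'M[k]_(a, b)) : polymx (fun=> A).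
Proof. by move=> i j; apply: polyfn_const. Qed.

Lemma polymxD a b (A1 A2 : X -> 'M[k]_(a, b)) :
  polymx A1 -> polymx A2 -> polymx (fun x => A1 x + A2 x).
Proof.
move=> h1 h2 i j; apply: polyfn_ext (polyfnD (h1 i j) (h2 i j)) => x.
by rewrite mxE.
Qed.

Lemma polymxN a b (A : X -> 'M[k]_(a, b)) :
  polymx A -> polymx (fun x => - A x).
Proof.
by move=> h i j; apply: polyfn_ext (polyfnN (h i j)) => x; rewrite mxE.
Qed.

Lemma polymxZ a b (h : X -> k) (A : X -> 'M[k]_(a, b)) :
  polyfn h -> polymx A -> polymx (fun x => h x *: A x).
Proof.
by move=> hh hA i j; apply: polyfn_ext (polyfnM hh (hA i j)) => x; rewrite mxE.
Qed.

Lemma polymx_tr a b (A : X -> 'M[k]_(a, b)) :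
  polymx A -> polymx (fun x => (A x)^T).
Proof. by move=> h i j; apply: polyfn_ext (h j i) => x; rewrite mxE. Qed.

Lemma polymxM a b d (A1 : X -> 'M[k]_(a, b)) (A2 : X -> 'M[k]_(b, d)) :
  polymx A1 -> polymx A2 -> polymx (fun x => A1 x *m A2 x).
Proof.
move=> h1 h2 i j; apply: (@polyfn_ext (fun x => \sum_l A1 x i l * A2 x l j)).
  by move=> x; rewrite mxE.
by apply: polyfn_sum => l _; apply: polyfnM; [exact: h1 | exact: h2].
Qed.

Lemma polyfn_det a (A : X -> 'M[k]_a) : polymx A -> polyfn (fun x => \det (A x)).
Proof.
move=> h; apply: polyfn_sum => s _; apply: polyfnM; first exact: polyfn_const.
by apply: polyfn_prod => i _; apply: h.
Qed.

End PolynomialFunctions.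

Definition line_coord (k : fieldType) (s : k) (_ : unit) := s.

Lemma polyfn_line (k : fieldType) (h : k -> k) :
  polyfn (@line_coord k) h -> exists q : {poly k}, forall s, h s = q.[s].
Proof.
move=> [p hp]; exists (\sum_(m <- msupp p) p@_m *: 'X^(mdeg m)) => s.
rewrite hp mevalE horner_sum; apply: eq_bigr => m _.
rewrite hornerZ hornerXn mdegE -prodrXr; congr (_ * _).
Qed.

(** This replaces a limit along a curve: what holds at its generic points holds
    at all of them. *)
Lemma polyfn_line_density (k : closedFieldType) (h e : k -> k) (s1 : k) :
    polyfn (@line_coord k) h -> polyfn (@line_coord k) e -> e s1 != 0 ->
  (forall s, e s != 0 -> h s = 0) -> forall s, h s = 0.
Proof.
move=> /polyfn_line[p hp] /polyfn_line[q hq] es1 h0 s.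
have : p * q = 0.
  apply: poly_fun_eq0 => x; rewrite hornerM -hp -hq.
  by have [->|/h0 ->] := eqVneq (e x) 0; rewrite ?mulr0 ?mul0r.
move=> /eqP; rewrite mulf_eq0 => /orP[/eqP p0|/eqP q0].
  by rewrite hp p0 horner0.
by rewrite hq q0 horner0 eqxx in es1.
Qed.

(** * Bounds on transcendence degrees *)

Section Degree.
Variables (k : fieldType) (M : nat).
Implicit Types (p q : {mpoly k[M]}).

Lemma msizeM_leS p q a b :
  (msize p <= a.+1)%N -> (msize q <= b.+1)%N -> (msize (p * q) <= (a + b).+1)%N.
Proof.
move=> pa qb; have [->|p0] := eqVneq p 0; first by rewrite mul0r msize0.
have [->|q0] := eqVneq q 0; first by rewrite mulr0 msize0.
by rewrite msizeM //; move: (msize p) (msize q) pa qb => ? ?; lia.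
Qed.

Lemma msizeX_leS p a e : (msize p <= a.+1)%N -> (msize (p ^+ e) <= (e * a).+1)%N.
Proof.
move=> pa; elim: e => [|e IHe]; first by rewrite expr0 msize1.
by rewrite exprS mulSn; apply: msizeM_leS.
Qed.

Lemma msize_prod_leS (I : finType) (F : I -> {mpoly k[M]}) (a : I -> nat) :
    (forall i, (msize (F i) <= (a i).+1)%N) ->
  (msize (\prod_i F i) <= (\sum_i a i).+1)%N.
Proof.
move=> Fa; elim/big_ind2: _ => //; first by rewrite msize1.
by move=> p1 a1 p2 a2; apply: msizeM_leS.
Qed.

End Degree.

(** The [B ^ d] monomials in [F_1 / H, ..., F_d / H] with exponents below [B],
    brought to the common denominator [H ^ (d B)], have degree [O(B)] in [M]
    variables; so they live in a space of dimension [O(B ^ M)], and are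
    linearly dependent for large [B] when [M < d]. *)
Lemma alg_dependent (k : fieldType) M d (F : 'I_d -> {mpoly k[M]})
    (H : {mpoly k[M]}) : (M < d)%N ->
  exists D q (u : 'I_q -> k) (m : 'I_q -> 'X_{1..d}),
    [/\ \sum_j u j *: 'X_[m j] != 0 :> {mpoly k[d]},
        forall j, (mdeg (m j) <= D)%N &
        \sum_j u j *: (\prod_i F i ^+ m j i * H ^+ (D - mdeg (m j))) = 0].
Proof.
move=> Md; pose e := (\max_i msize (F i) + msize H)%N.
pose B := ((e * d + 1) ^ M).+1; pose D := (d * B)%N.
pose mon (a : {ffun 'I_d -> 'I_B}) : 'X_{1..d} := [multinom (a i : nat) | i < d].
have mon_inj : injective mon.
  move=> a1 a2 /mnmP e12; apply/ffunP => i; apply: val_inj.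
  by have := e12 i; rewrite !mnmE.
have mdeg_mon a : (mdeg (mon a) <= D)%N.
  rewrite mdegE (leq_trans (n := \sum_(i < d) B)) //.
    by apply: leq_sum => i _; rewrite mnmE ltnW.
  by rewrite sum_nat_const card_ord.
pose T a := \prod_i F i ^+ mon a i * H ^+ (D - mdeg (mon a)).
have size_T a : (msize (T a) <= (e * D).+1)%N.
  have -> : (e * D = (\sum_i mon a i * e) + (D - mdeg (mon a)) * e)%N.
    by rewrite -big_distrl /= -mdegE -mulnDl subnKC // mulnC.
  apply: msizeM_leS.
    apply: msize_prod_leS => i; apply: msizeX_leS.
    have := @leq_bigmax _ (fun i => msize (F i)) i; rewrite /e; lia.
  by apply: msizeX_leS; rewrite /e; lia.
pose C := {ffun 'I_M -> 'I_(e * D).+1}.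
pose box (b : C) : 'X_{1..M} := [multinom (b i : nat) | i < M].
pose Q := \matrix_(i < #|{ffun 'I_d -> 'I_B}|, j < #|C|)
  (T (enum_val i))@_(box (enum_val j)).
have lt_card : (#|C| < #|{ffun 'I_d -> 'I_B}|)%N.
  rewrite !card_ffun !card_ord.
  apply: (@leq_ltn_trans (((e * d + 1) * B) ^ M)%N).
    have leq_expr2 a b j : (a <= b -> a ^ j <= b ^ j)%N.
      by case: j => // j; rewrite leq_exp2r.
    by apply: leq_expr2; rewrite /D mulnDl mul1n mulnA -addn1 leq_add2l.
  rewrite expnMn (@leq_trans (B ^ M.+1)%N) //; last by rewrite leq_pexp2l.
  by rewrite expnS ltn_pmul2r ?expn_gt0.
pose u := nz_row (kermx Q).
have u0 : u != 0.
  rewrite nz_row_eq0 kermx_eq0 /row_free neq_ltn.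
  by rewrite (leq_ltn_trans (rank_leq_col _)).
have uQ : u *m Q = 0 by apply/sub_kermxP/nz_row_sub.
pose P := \sum_i u 0 i *: 'X_[mon (enum_val i)].
have P_coef i : P@_(mon (enum_val i)) = u 0 i.
  rewrite raddf_sum (bigD1 i) //= mcoeffZ mcoeffX eqxx mulr1 big1 ?addr0 // => j ji.
  rewrite mcoeffZ mcoeffX; case: eqP => [/mon_inj/enum_val_inj ij|_].
    by rewrite ij eqxx in ji.
  by rewrite mulr0.
exists D, _, (u 0), (fun j => mon (enum_val j)); split=> [|j|].
- apply: contraNneq u0 => P0; apply/eqP/rowP => i.
  by rewrite -P_coef /P P0 mcoeff0 mxE.
- exact: mdeg_mon.
apply/mpolyP => m; rewrite mcoeff0 raddf_sum /=.
have [/forallP m_box|/forallPn[i]] := boolP [forall i, m i < (e * D).+1]%N.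
  pose b : C := [ffun i => Ordinal (m_box i)].
  have bm : box b = m by apply/mnmP => i; rewrite mnmE ffunE.
  have /rowP/(_ (enum_rank b)) := uQ; rewrite !mxE => uQb; rewrite -[RHS]uQb.
  by apply: eq_bigr => j _; rewrite mcoeffZ mxE enum_rankK bm.
rewrite -leqNgt => mi; rewrite big1 // => j _.
rewrite mcoeffZ memN_msupp_eq0 ?mulr0 //; apply: msize_mdeg_ge.
apply: leq_trans (size_T _) (leq_trans mi _).
by rewrite mdegE (bigD1 i) //= leq_addr.
Qed.

(** The dependence relation, cleared of denominators, is a polynomial that
    vanishes on the image of the parametrization, hence on [Y]; the product of
    the relations coming from the several parametrizations vanishes on all
    the images. *)
Lemma alg_independent_on_leq (k : fieldType) N (I J : finType)
    (phi : J -> (I -> k) -> 'rV[k]_N) (Y : 'rV[k]_N -> Prop) d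
    (f g : 'I_d -> {mpoly k[N]}) :
    (forall c i, polyfn id (fun t => phi c t 0 i)) ->
    (forall p, (forall c t, peval p (phi c t) = 0) ->
       forall x, Y x -> peval p x = 0) ->
  alg_independent_on Y f g -> (d <= #|I|)%N.
Proof.
move=> phi_poly Yphi [g_neq0 indep]; rewrite leqNgt; apply/negP => Id.
(* [f i / g i = f' i / h] *)
pose h : {mpoly k[N]} := \prod_i g i.
pose f' i : {mpoly k[N]} := f i * \prod_(j | j != i) g j.
have f'E x i : peval (g i) x != 0 ->
    peval (f' i) x = peval (f i) x / peval (g i) x * peval h x.
  have hE : h = g i * \prod_(j | j != i) g j by rewrite /h (bigD1 i).
  by move=> gx; rewrite hE /peval !mevalM mulrA divfK.
have rel c : exists (P : {mpoly k[d]}) (q : {mpoly k[N]}), [/\ P != 0,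
    forall t, peval q (phi c t) = 0 & forall x, (forall i, peval (g i) x != 0) ->
      peval q x = 0 -> P.@[fun i => peval (f i) x / peval (g i) x] = 0].
  have /fin_all_exists[Phi PhiE] := phi_poly c.
  pose pull (p : {mpoly k[N]}) := p \mPo [tuple Phi i | i < N].
  have pullE p t : (pull p).@[fun i => t (enum_val i)] = peval p (phi c t).
    rewrite comp_mpoly_meval; apply: meval_eq => i.
    by rewrite tnth_map tnth_ord_tuple PhiE.
  have [D [q [u [m [P0 mD rel]]]]] :=
    alg_dependent (fun i => pull (f' i)) (pull h) Id.
  exists (\sum_j u j *: 'X_[m j]).
  pose Q := \sum_j u j *: (\prod_i f' i ^+ m j i * h ^+ (D - mdeg (m j))).
  exists Q; split=> // [t|x gx].
    rewrite -pullE (_ : pull Q = 0) ?meval0 // -[RHS]rel.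
    rewrite /pull raddf_sum /=; apply: eq_bigr => j _.
    rewrite comp_mpolyZ rmorphM rmorphXn rmorph_prod; congr (_ *: (_ * _)).
    by apply: eq_bigr => i _; rewrite rmorphXn.
  have hx : peval h x != 0.
    by rewrite /peval rmorph_prod; apply/prodf_neq0 => i _; apply: gx.
  rewrite /peval !rmorph_sum /= => Qx.
  apply: (mulIf (expf_neq0 D hx)); rewrite mul0r -[RHS]Qx mulr_suml.
  apply: eq_bigr => j _; rewrite !mevalZ mevalX mevalM !rmorphXn /= -mulrA.
  congr (_ * _); rewrite -{1}(subnKC (mD j)) exprD mulrA; congr (_ * _).
  rewrite rmorph_prod mdegE -prodrXr -big_split; apply: eq_bigr => i _ /=.
  by rewrite rmorphXn -exprMn -f'E.
have /fin_all_exists[P /fin_all_exists[Q PQ]] := rel.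
have P0 : \prod_c P c = 0.
  apply: indep => x Yx gx.
  have : peval (\prod_c Q c) x = 0.
    apply: Yphi Yx => c t; rewrite /peval rmorph_prod (bigD1 c) //=.
    by have [_ /(_ t) Qc _] := PQ c; rewrite /peval in Qc; rewrite Qc mul0r.
  rewrite /peval !rmorph_prod => /eqP /prodf_eq0[c _ /eqP Qc].
  by rewrite (bigD1 c) //=; have [_ _ ->] := PQ c; rewrite ?mul0r.
have /eqP/prodf_eq0[c _ /eqP Pc] := P0.
by have [] := PQ c; rewrite Pc eqxx.
Qed.

(** If [P] vanishes on the values of [f], then so does its form of lowest
    degree on every vector [y]: that form is the leading term of [P] along a
    curve that [f] maps to [s y + O(s ^ 2)].  So no derivatives of [P] are
    needed, and the characteristic does not matter. *)
Lemma alg_independent_on_lines (k : closedFieldType) N M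
    (Y : 'rV[k]_N -> Prop) (f : 'I_M -> {mpoly k[N]}) :
    (forall y : 'I_M -> k, exists2 gamma : k -> 'rV[k]_N, forall s, Y (gamma s) &
       forall i, exists2 R : k -> k, polyfn (@line_coord k) R &
         forall s, peval (f i) (gamma s) = s * (y i + s * R s)) ->
  alg_independent_on Y f (fun=> 1).
Proof.
move=> lines; split=> [i|P P0].
  have [gamma Yg _] := lines (fun=> 0); exists (gamma 0) => //.
  by rewrite /peval meval1 oner_neq0.
apply/eqP; apply: contraT => Pn0; pose e := mdeg (mlast P).
have e_min m : m \in msupp P -> (e <= mdeg m)%N.
  by move=> /mlast_lemc/lemc_mdeg.
pose Pe := \sum_(m <- msupp P | mdeg m == e) P@_m *: 'X_[m] : {mpoly k[M]}.
have Pe0 : Pe = 0.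
  apply: mpoly_fun_eq0 => y; have [gamma Yg] := lines y.
  move=> /fin_all_exists2[R Rpoly gammaE].
  pose q s := \sum_(m <- msupp P)
    P@_m * (s ^+ (mdeg m - e) * \prod_i (y i + s * R i s) ^+ m i).
  have polyX h j : polyfn (@line_coord k) h ->
      polyfn (@line_coord k) (fun s => h s ^+ j).
    move=> hp; apply: (@polyfn_ext _ _ _ _ (fun s => \prod_(i < j) h s)) => [s|].
      by rewrite prodr_const card_ord.
    by apply: polyfn_prod.
  have line_id : polyfn (@line_coord k) id by exact: (polyfn_coord _ tt).
  have q_poly : polyfn (@line_coord k) q.
    apply: polyfn_sum => m _; apply: polyfnM; first exact: polyfn_const.
    apply: polyfnM; first exact: polyX.
    apply: polyfn_prod => i _; apply: polyX; apply: polyfnD.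
      exact: polyfn_const.
    by apply: polyfnM.
  have q0 s : s != 0 -> q s = 0.
    move=> s0; apply: (mulfI (expf_neq0 e s0)); rewrite mulr0.
    rewrite -[RHS](P0 (gamma s)) // => [|i]; last by rewrite /peval meval1 oner_neq0.
    rewrite mevalE mulr_sumr big_seq [RHS]big_seq; apply: eq_bigr => m mP.
    rewrite mulrCA; congr (_ * _); rewrite mulrA -exprD subnKC ?e_min //.
    rewrite mdegE -prodrXr -big_split; apply: eq_bigr => i _ /=.
    by rewrite -exprMn -gammaE /peval meval1 divr1.
  have := polyfn_line_density q_poly line_id (oner_neq0 k) q0 0.
  move=> <-; rewrite /Pe raddf_sum /= /q big_mkcond big_seq [RHS]big_seq.
  apply: eq_bigr => m mP; have := e_min m mP; rewrite leq_eqVlt eq_sym.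
  case: eqP => [-> _|/eqP ne /= lt]; last first.
    by rewrite expr0n subn_eq0 leqNgt lt mul0r mulr0.
  rewrite subnn expr0 mul1r mevalZ mevalX; congr (_ * _).
  by apply: eq_bigr => i _; rewrite mul0r addr0.
have lastP := mlast_supp Pn0.
have := congr1 (mcoeff (mlast P)) Pe0; rewrite mcoeff0 raddf_sum /=.
rewrite -big_filter (bigD1_seq (mlast P)) ?mem_filter ?lastP ?eqxx //=; last first.
  by rewrite filter_uniq // msupp_uniq.
rewrite mcoeffZ mcoeffX eqxx mulr1 big1 ?addr0 => [/eqP|m /negbTE mN].
  by rewrite mcoeff_eq0 lastP.
by rewrite mcoeffZ mcoeffX mN mulr0.
Qed.

(** The ring of polynomials on an affine space is a domain; irreducibility
    passes to the image, and to any set between the image and its closure. *)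
Lemma irreducible_dense_image (k : closedFieldType) N (I : finType)
    (phi : (I -> k) -> 'rV[k]_N) (S : 'rV[k]_N -> Prop) :
    (forall i, polyfn id (fun t => phi t 0 i)) -> (forall t, S (phi t)) ->
    (forall p, (forall t, peval p (phi t) = 0) ->
       forall x, S x -> peval p x = 0) ->
  irreducible S.
Proof.
move=> phi_poly Sphi phi_dense; split; first by exists (phi (fun=> 0)).
move=> C1 C2 [F1 F1P] [F2 F2P] SC.
have pull p : exists p' : {mpoly k[#|I|]}, forall t : I -> k,
    peval p (phi t) = p'.@[fun i => t (enum_val i)].
  exact: (polyfn_meval p phi_poly).
have split12 p1 p2 : F1 p1 -> F2 p2 ->
    (forall t, peval p1 (phi t) = 0) \/ (forall t, peval p2 (phi t) = 0).
  move=> Fp1 Fp2; have [q1 q1E] := pull p1; have [q2 q2E] := pull p2.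
  have : q1 * q2 = 0.
    apply: mpoly_fun_eq0 => v.
    have [t tE] : exists t : I -> k, v =1 (fun i => t (enum_val i)).
      by exists (fun i => v (enum_rank i)) => i; rewrite enum_valK.
    rewrite mevalM !(meval_eq _ tE) -q1E -q2E.
    case: (SC (phi t) (Sphi t)) => [/F1P/(_ _ Fp1) ->|/F2P/(_ _ Fp2) ->].
      by rewrite mul0r.
    by rewrite mulr0.
  move=> /eqP; rewrite mulf_eq0 => /orP[]/eqP q0; [left|right] => t.
    by rewrite q1E q0 meval0.
  by rewrite q2E q0 meval0.
have [[p1 [Fp1 np1]]|no] := Classical_Prop.classic
    (exists p, F1 p /\ ~ forall t, peval p (phi t) = 0).
  right=> x Sx; apply/F2P => p2 Fp2; apply: phi_dense Sx.
  by case: (split12 p1 p2 Fp1 Fp2).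
left=> x Sx; apply/F1P => p1 Fp1; apply: phi_dense Sx => t.
apply/eqP; apply: contraT => /eqP nz; case: no; exists p1; split=> //.
Qed.

(** * Hyperbolic frames of a symplectic space *)

Lemma mx_cV_inj (k : fieldType) p q (A : 'M[k]_(p, q)) :
  (forall x : 'cV_q, A *m x = 0 -> x = 0) -> \rank A = q.
Proof.
move=> inj; rewrite -mxrank_tr; apply/eqP/inj_row_free => v vA.
by apply: trmx_inj; rewrite trmx0; apply: inj; rewrite -[A]trmxK -trmx_mul vA trmx0.
Qed.

Lemma mx_cV_inj_unit (k : fieldType) p (A : 'M[k]_p) :
  (forall x : 'cV_p, A *m x = 0 -> x = 0) -> A \in unitmx.
Proof. by move=> /mx_cV_inj r; rewrite -row_free_unit /row_free r. Qed.

Lemma rank_cV_inj (k : fieldType) p q (A : 'M[k]_(p, q)) b (x : 'M_(q, b)) :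
  \rank A = q -> A *m x = 0 -> x = 0.
Proof.
move=> rA Ax; apply: trmx_inj; rewrite trmx0; apply: (@row_free_inj _ _ _ _ A^T).
  by rewrite /row_free mxrank_tr rA.
by rewrite /= mul0mx -trmx_mul Ax trmx0.
Qed.

Section HyperbolicFrame.
Variables (k : fieldType) (n : nat) (G : 'M[k]_n).
Hypotheses (two_neq0 : 2%:R != 0 :> k) (G_skew : G^T = - G) (G_unit : G \in unitmx).

Lemma gram_tr p q (A : 'M[k]_(n, p)) (C : 'M[k]_(n, q)) :
  (A^T *m G *m C)^T = - (C^T *m G *m A).
Proof. by rewrite !trmx_mul trmxK G_skew mulNmx mulmxN mulmxA. Qed.

Lemma gram_alt (x : 'cV[k]_n) : x^T *m G *m x = 0.
Proof.
have e := congr1 (fun A : 'M_1 => A 0 0) (gram_tr x x); rewrite !mxE in e.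
apply/matrixP => i j; rewrite !ord1 [RHS]mxE; move/eqP: e.
rewrite -addr_eq0 -mulr2n -mulr_natl mulf_eq0 (negbTE two_neq0) /= => /eqP.
by rewrite !mxE.
Qed.

Lemma gram_cV_eq0 (x : 'cV[k]_n) : G *m x = 0 -> x = 0.
Proof. by move=> Gx; rewrite -[x](mulKmx G_unit) Gx mulmx0. Qed.

Definition hyperbolic_pairs l (E F : 'M[k]_(n, l)) :=
  [/\ E^T *m G *m E = 0, F^T *m G *m F = 0 & E^T *m G *m F = 1%:M].

(** The last equation expands the identity of [V] along the decomposition
    [V = <E> + <K> + <F>]. *)
Definition hyperbolic_frame l m (E : 'M[k]_(n, l)) (K : 'M[k]_(n, m))
    (F : 'M[k]_(n, l)) :=
  [/\ hyperbolic_pairs E F, E^T *m G *m K = 0, F^T *m G *m K = 0,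
      K^T *m G *m K \in unitmx &
      F *m E^T - E *m F^T + K *m invmx (K^T *m G *m K) *m K^T = invmx G].

(** The columns of [E], [K] and [F] are linearly independent, hence form a basis
    of [V], on which the expansion of the identity can be checked. *)
Lemma hyperbolic_frame_of_rank l m (E : 'M[k]_(n, l)) (K : 'M_(n, m)) F :
    (l + (m + l) = n)%N -> hyperbolic_pairs E F -> E^T *m G *m K = 0 ->
    F^T *m G *m K = 0 -> \rank K = m -> hyperbolic_frame E K F.
Proof.
move=> n_eq EF KE KF rK; case: (EF) => [EE FF EF1].
have FE : F^T *m G *m E = - 1%:M.
  by rewrite -[LHS]opprK -gram_tr EF1 trmx1.
pose J := K^T *m G *m K; pose S := row_mx E (row_mx K F).
have KTE : K^T *m G *m E = 0 by rewrite -[LHS]opprK -gram_tr KE trmx0 oppr0.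
have KTF : K^T *m G *m F = 0 by rewrite -[LHS]opprK -gram_tr KF trmx0 oppr0.
have rS : \rank S = n.
  rewrite -[RHS]n_eq; apply: mx_cV_inj => x.
  rewrite -[x]vsubmxK -[dsubmx x]vsubmxK !mul_row_col => Sx.
  have := congr1 (mulmx (E^T *m G)) Sx.
  rewrite mulmx0 !mulmxDr !mulmxA EE KE EF1 !mul0mx !add0r mul1mx => x3.
  have := congr1 (mulmx (F^T *m G)) Sx.
  rewrite mulmx0 !mulmxDr !mulmxA FE KF FF !mul0mx !addr0 mulNmx mul1mx.
  move=> /eqP; rewrite oppr_eq0 => /eqP x1; move: Sx.
  rewrite x1 x3 !mulmx0 addr0 add0r => /(rank_cV_inj rK) ->.
  by rewrite !col_mx0.
have SG0 (y : 'cV_n) : E^T *m G *m y = 0 -> K^T *m G *m y = 0 ->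
    F^T *m G *m y = 0 -> y = 0.
  move=> Ey Ky Fy; apply: gram_cV_eq0; apply: (@rank_cV_inj _ _ _ S^T).
    by rewrite mxrank_tr.
  by rewrite !tr_row_mx !mul_col_mx !mulmxA Ey Ky Fy !col_mx0.
have J_unit : J \in unitmx.
  apply: mx_cV_inj_unit => x Jx; apply: (rank_cV_inj rK); apply: SG0.
  - by rewrite mulmxA KE mul0mx.
  - by rewrite mulmxA.
  - by rewrite mulmxA KF mul0mx.
split=> //; rewrite -/J; set X := (X in X = _).
suff -> : X = invmx G by [].
have XGS : X *m G *m S = S.
  rewrite /S !mul_mx_row /X !mulmxDl !mulNmx -!mulmxA !(mulmxA _^T G).
  rewrite EE KE EF1 FE KF FF KTE KTF -/J mulVmx // !mulmx0 !mulmxN !mulmx1.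
  by rewrite !subr0 !addr0 !add0r opprK.
have XG1 : X *m G = 1%:M.
  by apply: (@row_free_inj _ _ _ _ S); rewrite /= ?XGS ?mul1mx // /row_free rS.
by rewrite -[X]mulmx1 -(mulmxV G_unit) mulmxA XG1 mul1mx.
Qed.

Lemma hyperbolic_complement l m (E F : 'M[k]_(n, l)) : (l + (m + l) = n)%N ->
  hyperbolic_pairs E F -> exists K : 'M_(n, m), hyperbolic_frame E K F.
Proof.
move=> n_eq EF; case: (EF) => [EE FF EF1].
have FE : F^T *m G *m E = - 1%:M.
  by rewrite -[LHS]opprK -gram_tr EF1 trmx1.
suff [K [KE KF rK]] : exists K : 'M[k]_(n, m),
    [/\ E^T *m G *m K = 0, F^T *m G *m K = 0 & \rank K = m].
  by exists K; apply: hyperbolic_frame_of_rank.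
pose R := row_mx E F; have rR : \rank (R^T *m G) = (l + l)%N.
  rewrite mxrankMfree ?row_free_unit // mxrank_tr; apply: mx_cV_inj => x.
  rewrite -[x]vsubmxK mul_row_col => Rx.
  have := congr1 (mulmx (E^T *m G)) Rx; rewrite mulmx0 mulmxDr !mulmxA EE EF1.
  rewrite mul0mx add0r mul1mx => x2; move: Rx; rewrite x2 mulmx0 addr0.
  move=> /(congr1 (mulmx (F^T *m G))); rewrite mulmx0 mulmxA FE mulNmx mul1mx.
  by move=> /eqP; rewrite oppr_eq0 => /eqP ->; rewrite col_mx0.
pose C := kermx (R^T *m G)^T.
have rC : \rank C = m by rewrite mxrank_ker mxrank_tr rR; lia.
have RGC : R^T *m G *m (row_base C)^T = 0.
  apply: trmx_inj; rewrite trmx_mul trmxK trmx0; apply/sub_kermxP.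
  by rewrite eq_row_base.
move: (row_base C) RGC (row_base_free C); rewrite rC => A RGA /eqP rA.
exists A^T; rewrite mxrank_tr rA; move: RGA.
rewrite /R tr_row_mx !mul_col_mx -[0]vsubmxK => /eq_col_mx[-> ->].
by rewrite !linear0.
Qed.

(** The orthogonal of the pairs already found is nondegenerate, so it contains
    two vectors with product [1]. *)
Lemma hyperbolic_pairs_exist l : (l.*2 <= n)%N ->
  exists E F : 'M_(n, l), hyperbolic_pairs E F.
Proof.
elim: l => [|l IHl] ln.
  by exists 0, 0; split; rewrite [LHS]flatmx0 // [RHS]flatmx0.
have [|E [F EF]] := IHl; first by lia.
have n_eq : (l + ((n - l.*2) + l) = n)%N by lia.
have [K [[EE FF EF1] KE KF J_unit _]] := hyperbolic_complement n_eq EF.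
set J := K^T *m G *m K in J_unit.
have FE : F^T *m G *m E = - 1%:M.
  by rewrite -[LHS]opprK -gram_tr EF1 trmx1.
have KTE : K^T *m G *m E = 0 by rewrite -[LHS]opprK -gram_tr KE trmx0 oppr0.
have KTF : K^T *m G *m F = 0 by rewrite -[LHS]opprK -gram_tr KF trmx0 oppr0.
have [i [j Jij]] : exists i j, J i j != 0.
  have [[i j] /= Jij|J0] := pickP (fun p => J p.1 p.2 != 0); first by exists i, j.
  have J0' : J = 0.
    by apply/matrixP => i j; have /= /negbFE/eqP -> := J0 (i, j); rewrite mxE.
  have i0 : 'I_(n - l.*2) by apply: (@Ordinal _ 0); lia.
  have /matrixP/(_ i0 0)/eqP := mulKmx J_unit (delta_mx i0 0 : 'cV_(n - l.*2)).
  by rewrite J0' mul0mx mulmx0 !mxE !eqxx eq_sym oner_eq0.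
rewrite -[l.+1]addn1.
pose x := delta_mx i 0 : 'cV[k]_(n - l.*2).
pose y := (J i j)^-1 *: delta_mx j 0 : 'cV[k]_(n - l.*2).
exists (row_mx E (K *m x)), (row_mx F (K *m y)).
have gram0 (A : 'M_(n, l)) (z : 'cV_(n - l.*2)) :
    A^T *m G *m K = 0 -> A^T *m G *m (K *m z) = 0.
  by move=> AK; rewrite mulmxA AK mul0mx.
have gramC0 p (A : 'M_(n, p)) q (C : 'M_(n, q)) :
    A^T *m G *m C = 0 -> C^T *m G *m A = 0.
  by move=> h; rewrite -[LHS]opprK -gram_tr h trmx0 oppr0.
have [Ex Ey Fx Fy] : [/\ E^T *m G *m (K *m x) = 0, E^T *m G *m (K *m y) = 0,
    F^T *m G *m (K *m x) = 0 & F^T *m G *m (K *m y) = 0].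
  by split; apply: gram0.
have xy : (K *m x)^T *m G *m (K *m y) = 1%:M.
  rewrite trmx_mul !mulmxA -(mulmxA _ K^T) -(mulmxA x^T) -/J -scalemxAr.
  rewrite trmx_delta -rowE -colE [LHS]mx11_scalar !mxE.
  by rewrite mulVf //; move: Jij; rewrite mxE.
rewrite /hyperbolic_pairs !tr_row_mx !(mul_col_mx _ _ G) !mul_col_row EE FF EF1.
rewrite !gram_alt Ex Ey Fy xy (gramC0 _ _ _ _ Ex) (gramC0 _ _ _ _ Fx).
rewrite (gramC0 _ _ _ _ Fy) -scalar_mx_block.
by split=> //; rewrite /block_mx !row_mx0 col_mx0.
Qed.
End HyperbolicFrame.

(** * Nondegenerate subspaces in coordinates *)

Lemma trmxD (k : fieldType) p q (A B : 'M[k]_(p, q)) : (A + B)^T = A^T + B^T.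
Proof. by rewrite linearD. Qed.

Lemma eq_mx_cV (k : fieldType) p q (A B : 'M[k]_(p, q)) :
  (forall x : 'cV_q, A *m x = B *m x) -> A = B.
Proof.
by move=> AB; apply/matrixP => i j; have /colP/(_ i) := AB (delta_mx j 0);
  rewrite -!colE !mxE.
Qed.

Lemma row_perm_unit (k : fieldType) a b (Q : 'M[k]_(a + b, a)) :
  \rank Q = a -> exists s : 'S_(a + b), usubmx (row_perm s Q) \in unitmx.
Proof.
move=> rQ; have fQ : row_full Q by rewrite /row_full rQ.
set f := fullrankfun fQ; have f_inj : injective f by exact: fullrankfun_inj.
pose C := ~: [set f i | i in 'I_a].
have cC : b = #|C|.
  have := cardsC [set f i | i in 'I_a]; rewrite -/C card_imset // !card_ord.
  by move/addnI.
pose g x := match split x with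
  | inl i => f i
  | inr j => enum_val (cast_ord cC j)
  end.
have gC j : enum_val (cast_ord cC j) \in C by exact: enum_valP.
have g_inj : injective g.
  move=> x y; rewrite /g; case: splitP => i xi; case: splitP => j yj.
  - by move=> /f_inj ij; apply: val_inj; rewrite /= xi yj ij.
  - by move=> ij; have := gC j; rewrite -ij inE imset_f.
  - by move=> ij; have := gC i; rewrite ij inE imset_f.
  - by move=> /enum_val_inj/cast_ord_inj ij; apply: val_inj; rewrite /= xi yj ij.
exists (perm g_inj); have -> : usubmx (row_perm (perm g_inj) Q) = rowsub f Q.
  apply/matrixP => i j; rewrite !mxE permE /g; case: splitP => [i' /= e|j' /= e].
    by congr (Q (f _) j); apply: val_inj.
  by have := ltn_ord i; rewrite e ltnNge leq_addr.
exact: fullrowsub_unit.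
Qed.

Section NondegenerateChart.
Variables (k : fieldType) (a b : nat) (J : 'M[k]_(a + b)).
Hypotheses (J_skew : J^T = - J) (J_unit : J \in unitmx).

(** The columns of [chart1 s T] span the graph of [T], in coordinates permuted
    by [s].  Those of [chart2 s T] span its orthogonal, and are linear in [T]
    since [J] maps the orthogonal to the annihilator of the graph. *)
Definition chart1 (s : 'S_(a + b)) (T : 'M[k]_(b, a)) : 'M[k]_(a + b, a) :=
  lsubmx (perm_mx s) + rsubmx (perm_mx s) *m T.

Definition chart2 (s : 'S_(a + b)) (T : 'M[k]_(b, a)) : 'M[k]_(a + b, b) :=
  invmx J *m (rsubmx (perm_mx s) - lsubmx (perm_mx s) *m T^T).

(** In the basis formed by the columns of [chart1 s T] and [chart2 s T], both [D]
    and the inverse of [J] are block diagonal.  The Gram matrices of the two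
    blocks disappear into [c1] and [c2], so that the right-hand side is polynomial
    in [T], [c1] and [c2]. *)
Lemma nondegenerate_chart (Q : 'M[k]_(a + b, a)) : Q^T *m J *m Q \in unitmx ->
  exists s T, forall D : 'M_(a + b), (exists D1, D *m Q = Q *m D1) ->
    (forall y : 'cV_(a + b), Q^T *m J *m y = 0 -> Q^T *m J *m (D *m y) = 0) ->
  exists c1 c2, D *m invmx J =
    chart1 s T *m c1 *m (chart1 s T)^T + chart2 s T *m c2 *m (chart2 s T)^T.
Proof.
move=> h_unit; have rQ : \rank Q = a.
  apply: mx_cV_inj => x Qx; rewrite -[x](mulKmx h_unit) -[X in _ *m X]mulmxA Qx.
  by rewrite !mulmx0.
have [s0 u_unit] := row_perm_unit rQ; pose s := (s0^-1)%g; exists s.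
pose Nf : 'M[k]_(a + b, a) := lsubmx (perm_mx s).
pose Ng : 'M[k]_(a + b, b) := rsubmx (perm_mx s).
have N_eq : perm_mx s = row_mx Nf Ng :> 'M[k]_(a + b) by rewrite hsubmxK.
have NTN : (perm_mx s)^T *m perm_mx s = 1%:M :> 'M[k]_(a + b).
  by rewrite tr_perm_mx -perm_mxM mulVg perm_mx1.
have NNT : perm_mx s *m (perm_mx s)^T = 1%:M :> 'M[k]_(a + b).
  by rewrite tr_perm_mx -perm_mxM mulgV perm_mx1.
move: NTN NNT; rewrite N_eq tr_row_mx mul_col_row mul_row_col.
rewrite [1%:M in X in X -> _]scalar_mx_block => /eq_block_mx[ff fg gf gg] NN.
have uE : usubmx (row_perm s0 Q) = Nf^T *m Q.
  rewrite row_permE -[s0]invgK -/s -tr_perm_mx N_eq tr_row_mx mul_col_mx.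
  by rewrite col_mxKu.
rewrite uE in u_unit; set u := Nf^T *m Q in u_unit.
pose T := Ng^T *m Q *m invmx u; exists T => D [D1 DQ] DQperp.
have P1E : chart1 s T = Nf + Ng *m T by [].
have P2E : chart2 s T = invmx J *m (Ng - Nf *m T^T) by [].
set P1 := chart1 s T in P1E *; set P2 := chart2 s T in P2E *.
have QE : Q = P1 *m u.
  rewrite P1E mulmxDl /T -!mulmxA mulVmx // mulmx1 !mulmxA -mulmxDl.
  by rewrite NN mul1mx.
clearbody P1 P2 T u; have uT_unit : u^T \in unitmx by rewrite unitmx_tr.
have JP2 : J *m P2 = Ng - Nf *m T^T by rewrite P2E mulKVmx.
have NfJP2 : Nf^T *m (J *m P2) = - T^T.
  by rewrite JP2 mulmxBr fg mulmxA ff mul1mx add0r.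
have NgJP2 : Ng^T *m (J *m P2) = 1%:M.
  by rewrite JP2 mulmxBr gg mulmxA gf mul0mx subr0.
have P1JP2 : P1^T *m J *m P2 = 0.
  rewrite -mulmxA P1E trmxD trmx_mul mulmxDl NfJP2 -mulmxA NgJP2 mulmx1.
  by rewrite addNr.
have P2JP1 : P2^T *m J *m P1 = 0.
  by rewrite -[LHS]opprK -(gram_tr J_skew) P1JP2 trmx0 oppr0.
have perpP2 (y : 'cV_(a + b)) : Q^T *m J *m y = 0 -> y = P2 *m (Ng^T *m J *m y).
  move=> Qy; have Py : Nf^T *m (J *m y) + T^T *m (Ng^T *m (J *m y)) = 0.
    have : u^T *m (P1^T *m (J *m y)) = 0 by rewrite -[RHS]Qy QE trmx_mul -!mulmxA.
    move=> /(canRL (mulKmx uT_unit)); rewrite mulmx0 => <-.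
    by rewrite P1E trmxD trmx_mul mulmxDl !mulmxA.
  rewrite P2E -[RHS]mulmxA; apply: (canRL (mulKmx J_unit)).
  rewrite -[LHS]mul1mx -NN mulmxDl mulmxBl [RHS]addrC -!mulmxA; congr (_ + _).
  by move/eqP: Py; rewrite addr_eq0 => /eqP ->; rewrite mulmxN.
have h1_unit : P1^T *m J *m P1 \in unitmx.
  have := h_unit; rewrite QE trmx_mul -!mulmxA unitmx_mul => /andP[_].
  by rewrite !mulmxA unitmx_mul => /andP[].
have P_inj (x : 'cV_a) (y : 'cV_b) : P1 *m x + P2 *m y = 0 -> x = 0 /\ y = 0.
  move=> Pxy; have := congr1 (mulmx (P1^T *m J)) Pxy.
  rewrite mulmxDr !mulmxA P1JP2 mul0mx addr0 mulmx0 => /(canRL (mulKmx h1_unit)).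
  rewrite mulmx0 => x0; have := congr1 (mulmx (Ng^T *m J)) Pxy.
  rewrite x0 !mulmx0 add0r -!mulmxA (mulmxA J) (mulmxA Ng^T) NgJP2.
  by rewrite mul1mx.
set h1 := P1^T *m J *m P1 in h1_unit *; pose h2 := P2^T *m J *m P2.
pose P := row_mx P1 P2; have P_unit : P \in unitmx.
  apply: mx_cV_inj_unit => x; rewrite -[x]vsubmxK mul_row_col.
  by move=> /P_inj[-> ->]; rewrite col_mx0.
have h2_unit : h2 \in unitmx.
  apply: mx_cV_inj_unit => y hy; apply: (proj2 (P_inj 0 y _)).
  rewrite mulmx0 add0r; suff : P^T *m (J *m (P2 *m y)) = 0.
    have PT_unit : P^T \in unitmx by rewrite unitmx_tr.
    move=> /(canRL (mulKmx PT_unit)); rewrite mulmx0.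
    by move=> /(canRL (mulKmx J_unit)); rewrite mulmx0.
  by rewrite tr_row_mx mul_col_mx !mulmxA P1JP2 -/h2 hy mul0mx col_mx0.
have resolution : P1 *m invmx h1 *m P1^T + P2 *m invmx h2 *m P2^T = invmx J.
  set X := LHS; have XJP : X *m J *m P = P.
    rewrite /P mul_mx_row /X !mulmxDl -!mulmxA !(mulmxA _^T J) P1JP2 P2JP1.
    by rewrite -/h1 -/h2 !mulVmx // !mulmx0 !mulmx1 addr0 add0r.
  have XJ : X *m J = 1%:M by rewrite -[LHS](mulmxK P_unit) XJP mulmxV.
  by rewrite -[LHS](mulmxK J_unit) XJ mul1mx.
have [D2 DP1] : exists D2, D *m P1 = P1 *m D2.
  exists (u *m D1 *m invmx u).
  by rewrite !mulmxA -QE -DQ QE mulmxA mulmxK.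
have [D3 DP2] : exists D3, D *m P2 = P2 *m D3.
  exists (Ng^T *m J *m (D *m P2)); apply: eq_mx_cV => x.
  rewrite -!mulmxA; have := perpP2 (D *m (P2 *m x)); rewrite -!mulmxA; apply.
  rewrite mulmxA; apply: DQperp; rewrite QE trmx_mul -!mulmxA (mulmxA P1^T).
  by rewrite (mulmxA (P1^T *m J)) P1JP2 mul0mx mulmx0.
exists (D2 *m invmx h1), (D3 *m invmx h2).
by rewrite -resolution mulmxDr !mulmxA DP1 DP2.
Qed.

End NondegenerateChart.

(** * Normal form of the endomorphisms with a given invariant subspace *)

Section NormalForm.
Variables (k : fieldType) (n : nat) (G : 'M[k]_n).
Hypotheses (two_neq0 : 2%:R != 0 :> k) (G_skew : G^T = - G) (G_unit : G \in unitmx).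

Local Notation frame := (hyperbolic_frame G).

Lemma gram0C p q (A : 'M[k]_(n, p)) (C : 'M[k]_(n, q)) :
  A^T *m G *m C = 0 -> C^T *m G *m A = 0.
Proof. by move=> h; rewrite -[LHS]opprK -(gram_tr G_skew) h trmx0 oppr0. Qed.

Section Frame.
Variables (l m : nat) (E : 'M[k]_(n, l)) (K : 'M[k]_(n, m)) (F : 'M[k]_(n, l)).
Hypothesis EKF : frame E K F.
Local Notation J := (K^T *m G *m K).

Lemma frame_gramFE : F^T *m G *m E = - 1%:M.
Proof.
by have [[_ _ EF] _ _ _ _] := EKF; rewrite -[LHS]opprK -(gram_tr G_skew) EF trmx1.
Qed.

Lemma frame_gram_skew : J^T = - J.
Proof. exact: gram_tr. Qed.

Lemma frame_expand p (x : 'M[k]_(n, p)) :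
  x = E *m (- (F^T *m G *m x)) + K *m (invmx J *m (K^T *m G *m x)) +
      F *m (E^T *m G *m x).
Proof.
have [_ _ _ _ res] := EKF; rewrite -[LHS](mulKmx G_unit) -res !mulmxDl mulNmx.
by rewrite mulmxN -!mulmxA [in RHS]addrC addrA.
Qed.

(** Since [E' = E + K Y + F Z] for some [Y] and [Z], correcting [K] by a
    multiple of [F] makes it orthogonal to [E'] again. *)
Definition moved_K (E' : 'M[k]_(n, l)) := K - F *m (E'^T *m G *m K).

Lemma moved_K_gram E' : (moved_K E')^T *m G *m moved_K E' = J.
Proof.
have [[_ FF _] _ FK _ _] := EKF; have KF := gram0C FK.
rewrite /moved_K; move: (E'^T *m G *m K) => C; set W := K - _.
have FW : F^T *m G *m W = 0 by rewrite mulmxBr FK mulmxA FF mul0mx subrr.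
have KW : K^T *m G *m W = J by rewrite mulmxBr mulmxA KF mul0mx subr0.
by rewrite {1}/W [(_ - _)^T]raddfB /= trmx_mul !mulmxBl KW -!mulmxA
  (mulmxA F^T) FW mulmx0 subr0.
Qed.

Lemma moved_frame E' : (l + (m + l) = n)%N -> hyperbolic_pairs G E' F ->
  frame E' (moved_K E') F.
Proof.
move=> n_eq E'F; have [_ FF E'F1] := E'F; have [_ _ FK J_unit _] := EKF.
apply: hyperbolic_frame_of_rank => //.
- by rewrite /moved_K mulmxBr (mulmxA _ F) E'F1 mul1mx subrr.
- by rewrite /moved_K mulmxBr FK (mulmxA _ F) FF mul0mx subrr.
apply: mx_cV_inj => x Kx; have Jx : J *m x = 0.
  by rewrite -(moved_K_gram E') -mulmxA Kx mulmx0.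
by rewrite -[x](mulKmx J_unit) Jx mulmx0.
Qed.

(** In terms of the tensor [A G^-1], written in the frame of [E'], invariance of
    [<E'>] and of its orthogonal means that the components in [F F], [F K] and
    [K F] vanish. *)
Definition invariant_mx (E' : 'M[k]_(n, l)) (X : 'M_(l, n)) (X2 : 'M_(m, l))
    (X3 : 'M_l) (C : 'M_m) : 'M_n :=
  (E' *m X + (K *m X2 + F *m X3) *m E'^T + moved_K E' *m C *m (moved_K E')^T) *m G.

(** Every column of [A] is expanded with [frame_expand] for the frame of [E'];
    the blocks that vanish say that [<E'>] and its orthogonal are invariant. *)
Lemma invariant_mx_exists E' (A : 'M_n) (U : 'M_l) V (D : 'M_m) :
    (l + (m + l) = n)%N -> hyperbolic_pairs G E' F ->
    A *m E' = E' *m U -> A *m moved_K E' = E' *m V + moved_K E' *m D ->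
  exists X X2 X3, A = invariant_mx E' X X2 X3 (D *m invmx J).
Proof.
move=> n_eq E'F AE AK; have E'KF := moved_frame n_eq E'F.
have [_ _ _ _ res'] := E'KF; have J'E := moved_K_gram E'.
have idE : 1%:M = F *m E'^T *m G - E' *m F^T *m G +
    moved_K E' *m invmx J *m (moved_K E')^T *m G :> 'M_n.
  by rewrite -mulmxBl -mulmxDl -J'E res' mulVmx.
have FE' : F^T *m G *m E' = - 1%:M.
  by have [_ _ E'F1] := E'F; rewrite -[LHS]opprK -(gram_tr G_skew) E'F1 trmx1.
have := frame_expand (A *m F).
move: (- _) (invmx J *m _) (E^T *m G *m _) => x1 x2 x3 AF.
have := frame_expand E'; rewrite FE' opprK mulmx1.
move: (invmx J *m _) (E^T *m G *m _) => y z E'E.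
exists (x1 *m E'^T - U *m F^T + V *m invmx J *m (moved_K E')^T).
exists (x2 - y *m x1), (x3 - z *m x1).
have AF' : A *m F = E' *m x1 + (K *m (x2 - y *m x1) + F *m (x3 - z *m x1)).
  rewrite AF [in RHS]E'E !mulmxDl !mulmxBr !mulmxA -!addrA; congr (_ + _).
  rewrite (addrCA (K *m x2)) (addrCA (F *m z *m x1)) addNKr.
  by rewrite (addrCA (F *m z *m x1)) subrKC.
rewrite -[LHS]mulmx1 idE mulmxDr mulmxBr !mulmxA AF' AE AK /invariant_mx.
move: (K *m _ + F *m _) (moved_K E') => L K'.
rewrite mulmxDr mulmxBr !mulmxDl !mulNmx !mulmxA !addrA; congr (_ + _).
by rewrite [RHS]addrAC; congr (_ + _); rewrite addrAC.
Qed.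

(** By this formula, the isotropic subspaces transverse to [<K, F>] form an
    affine space: [Y] is free, and [Z] is determined up to a symmetric matrix. *)
Lemma frame_gram_moved (Y : 'M_(m, l)) (Z : 'M_l) (E' := E + K *m Y + F *m Z) :
  E'^T *m G *m E' = Z - Z^T + Y^T *m J *m Y /\ F^T *m G *m E' = - 1%:M.
Proof.
have [[EE FF EF] EK FK _ _] := EKF.
have FE := frame_gramFE; have KE := gram0C EK; have KF := gram0C FK.
have GE : E^T *m G *m E' = Z.
  by rewrite !mulmxDr EE !(mulmxA (E^T *m G)) EK EF mul0mx mul1mx !add0r.
have GF : F^T *m G *m E' = - 1%:M.
  by rewrite !mulmxDr FE !(mulmxA (F^T *m G)) FK FF !mul0mx !addr0.
have GK : K^T *m G *m E' = J *m Y.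
  by rewrite !mulmxDr KE !(mulmxA (K^T *m G)) KF mul0mx addr0 add0r.
split=> //; rewrite {1}/E' 2!trmxD 2!trmx_mul !mulmxDl GE -!mulmxA.
rewrite !(mulmxA _^T G) GF GK mulmxN mulmx1 addrAC.
by rewrite !mulmxA.
Qed.

Lemma frame_isotropic (E' : 'M[k]_(n, l)) : E'^T *m G *m E' = 0 ->
    F^T *m G *m E' = - 1%:M ->
  exists Y Z, E' = E + K *m Y + F *m Z /\ Z - Z^T + Y^T *m J *m Y = 0.
Proof.
move=> E'E' FE'; have := frame_expand E'; rewrite FE' opprK mulmx1.
move: (invmx J *m _) (E^T *m G *m _) => Y Z E'E; exists Y, Z; split=> //.
by have [<- _] := frame_gram_moved Y Z; rewrite -E'E.
Qed.

End Frame.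

(** The first two conditions say that the span of [M] and [R] is invariant, the
    third that its orthogonal is. *)
Definition preserves_mx l a (M : 'M[k]_(n, l)) (R : 'M[k]_(n, a)) (A : 'M[k]_n) :=
  [/\ exists U, A *m M = M *m U, exists V D, A *m R = M *m V + R *m D &
      forall x : 'cV_n, M^T *m G *m x = 0 -> R^T *m G *m x = 0 ->
        M^T *m G *m (A *m x) = 0 /\ R^T *m G *m (A *m x) = 0].

Definition adapted_basis l a (M : 'M[k]_(n, l)) (R : 'M[k]_(n, a)) :=
  [/\ \rank M = l, M^T *m G *m M = 0, M^T *m G *m R = 0 &
      R^T *m G *m R \in unitmx].

(** In the frame moved so that [E'] spans the same space as [M], the
    endomorphism induced on [<M>^perp / <M>] preserves the nondegenerate image
    of [R], and [nondegenerate_chart] applies to it. *)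
Lemma invariant_normal_form l a b (E : 'M[k]_(n, l)) (K : 'M_(n, a + b)) F
    (M : 'M_(n, l)) (R : 'M_(n, a)) (J := K^T *m G *m K) :
    (l + ((a + b) + l) = n)%N -> frame E K F -> adapted_basis M R ->
    F^T *m G *m M \in unitmx ->
  exists Y Z s T, Z - Z^T + Y^T *m J *m Y = 0 /\
    forall A, preserves_mx M R A -> exists X X2 X3 c1 c2,
      A = invariant_mx K F (E + K *m Y + F *m Z) X X2 X3
        (chart1 s T *m c1 *m (chart1 s T)^T +
         chart2 J s T *m c2 *m (chart2 J s T)^T).
Proof.
move=> n_eq EKF [_ MM MR h_unit] FM_unit.
have [[EE FF EF] EK FK J_unit _] := EKF.
pose w := - invmx (F^T *m G *m M); pose E' := M *m w.
have w_unit : w \in unitmx by rewrite /w -scaleN1r unitmxZ ?unitrN1 ?unitmx_inv.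
have ME' : M = E' *m invmx w by rewrite mulmxK.
have FE' : F^T *m G *m E' = - 1%:M by rewrite mulmxA mulmxN mulmxV.
have E'F : hyperbolic_pairs G E' F.
  split=> //; first by rewrite trmx_mul -!mulmxA !(mulmxA M^T) !(mulmxA _ M) MM
    mul0mx mulmx0.
  by rewrite -[LHS]opprK -(gram_tr G_skew) FE' [(- _)^T]raddfN /= trmx1 opprK.
have E'E' : E'^T *m G *m E' = 0 by have [] := E'F.
have E'KF := moved_frame EKF n_eq E'F.
have [Y [Z [E'E YZ]]] := frame_isotropic EKF E'E' FE'; exists Y, Z.
have K'K' := moved_K_gram EKF E'; rewrite -/J in K'K'.
have inv := invariant_mx_exists EKF n_eq E'F.
have [_ E'K' _ _ _] := E'KF.
move: (moved_K K F E') E'KF K'K' E'K' inv => K' E'KF K'K' E'K' inv.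
have K'E' := gram0C E'K'.
have E'R : E'^T *m G *m R = 0 by rewrite trmx_mul -!mulmxA (mulmxA M^T) MR mulmx0.
have EM : E' = M *m w by [].
clearbody E'; have [e [Q RE]] : exists e Q, R = E' *m e + K' *m Q.
  have := frame_expand E'KF R; rewrite E'R mulmx0 addr0.
  by move: (- _) (invmx _ *m _) => e Q RE; exists e, Q.
have RK' : R^T *m G *m K' = Q^T *m J.
  rewrite RE trmxD 2!trmx_mul !mulmxDl -!mulmxA.
  by rewrite !(mulmxA _^T G) E'K' K'K' mulmx0 add0r.
have QQ : Q^T *m J *m Q = R^T *m G *m R.
  by rewrite [X in _ = _ *m X]RE mulmxDr (mulmxA _ E') (mulmxA _ K') RK'
    (gram0C E'R) mul0mx add0r.
have Q_unit : Q^T *m J *m Q \in unitmx by rewrite QQ.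
have J_skew : J^T = - J by exact: gram_tr.
have [s [T chart]] := nondegenerate_chart J_skew J_unit Q_unit.
exists s, T; split=> // A [[U AM] [V [D1 AR]] Aperp].
have AE' : A *m E' = E' *m (invmx w *m U *m w).
  by rewrite !mulmxA -ME' -AM EM mulmxA.
have MK' : M^T *m G *m K' = 0.
  by rewrite ME' trmx_mul -!mulmxA (mulmxA E'^T) E'K' mulmx0.
have AK'E' : E'^T *m G *m (A *m K') = 0.
  rewrite {1}EM trmx_mul -!mulmxA (mulmxA M^T); suff -> : M^T *m G *m (A *m K') = 0.
    by rewrite mulmx0.
  apply: eq_mx_cV => y; rewrite mul0mx -!mulmxA.
  (* [K' y] minus its component in [<R>] is orthogonal to [M] and [R] *)
  pose x := K' *m y - R *m (invmx (R^T *m G *m R) *m (R^T *m G *m (K' *m y))).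
  have [||+ _] := Aperp x.
  - by rewrite mulmxBr !(mulmxA (M^T *m G)) MK' MR !mul0mx subrr.
  - by rewrite mulmxBr !(mulmxA (R^T *m G) R) mulKVmx // subrr.
  rewrite mulmxBr (mulmxA A R) AR mulmxBr mulmxDl mulmxDr -!(mulmxA M) -!(mulmxA R).
  rewrite !(mulmxA (M^T *m G)) MM MR !mul0mx addr0 subr0 => <-.
  by rewrite !mulmxA.
have [V' [D AK']] : exists V' D, A *m K' = E' *m V' + K' *m D.
  have := frame_expand E'KF (A *m K'); rewrite AK'E' mulmx0 addr0.
  by move: (- _) (invmx _ *m _) => V' D AK'; exists V', D.
have DQ : D *m Q = Q *m D1.
  have : A *m R = E' *m (invmx w *m U *m w *m e + V' *m Q) + K' *m (D *m Q).
    by rewrite {1}RE mulmxDr !mulmxA AE' AK' mulmxDl mulmxDr !mulmxA addrA.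
  rewrite AR {1}ME' {1}RE => /(congr1 (mulmx (K'^T *m G))).
  rewrite !mulmxDl !mulmxDr -!(mulmxA E') -!(mulmxA K') !(mulmxA (K'^T *m G)).
  rewrite K'E' K'K' !mul0mx !add0r.
  by move=> /(canRL (mulKmx J_unit)); rewrite mulKmx.
have Dperp (y : 'cV_(a + b)) : Q^T *m J *m y = 0 -> Q^T *m J *m (D *m y) = 0.
  rewrite -RK' => RK'y; have [||_] := Aperp (K' *m y).
  - by rewrite mulmxA MK' mul0mx.
  - by rewrite mulmxA.
  rewrite (mulmxA A) AK' mulmxDl mulmxDr -!(mulmxA E') -!(mulmxA K').
  by rewrite !(mulmxA (R^T *m G)) (gram0C E'R) mul0mx add0r.
have [c1 [c2 DJ]] := chart D (ex_intro _ D1 DQ) Dperp.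
have [X [X2 [X3 AE]]] := inv A _ _ _ AE' AK'.
by exists X, X2, X3, c1, c2; rewrite -DJ -E'E.
Qed.
End NormalForm.

(** * Moving a subspace into general position by transvections *)

Section Transvections.
Variables (k : closedFieldType) (n : nat) (G : 'M[k]_n).
Hypotheses (two_neq0 : 2%:R != 0 :> k) (G_skew : G^T = - G) (G_unit : G \in unitmx).

Definition transvection (s : k) (v : 'cV[k]_n) : 'M[k]_n :=
  1%:M + s *: (v *m v^T *m G).

Definition tv_prod s vs := foldr (fun v P => P *m transvection s v) 1%:M vs.

Definition tv_prodV s vs := foldr (fun v P => transvection (- s) v *m P) 1%:M vs.

Lemma transvectionK s v : transvection s v *m transvection (- s) v = 1%:M.
Proof.
rewrite /transvection mulmxDl mul1mx !mulmxDr !mulmx1 -scalemxAl -scalemxAr.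
rewrite (_ : _ *m (v *m v^T *m G) = 0) ?scaler0 ?addr0; last first.
  rewrite -!mulmxA (mulmxA v^T) (mulmxA (v^T *m G)) (gram_alt two_neq0 G_skew).
  by rewrite mul0mx mulmx0.
by rewrite scaleNr addrAC addrK.
Qed.

Lemma transvection_gram s v : (transvection s v)^T *m G = G *m transvection (- s) v.
Proof.
rewrite /transvection trmxD trmx1 linearZ /= !trmx_mul trmxK G_skew.
rewrite mulmxDl mul1mx mulmxDr mulmx1 -scalemxAl -scalemxAr !mulNmx scaleNr scalerN.
by rewrite !mulmxA.
Qed.

Lemma tv_prodK s vs : tv_prod s vs *m tv_prodV s vs = 1%:M.
Proof.
elim: vs => [|v vs IHvs] /=; first by rewrite mulmx1.
by rewrite mulmxA -(mulmxA (tv_prod _ _)) transvectionK mulmx1.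
Qed.

Lemma tv_prodVK s vs : tv_prodV s vs *m tv_prod s vs = 1%:M.
Proof. exact: mulmx1C (tv_prodK s vs). Qed.

Lemma tv_prod_gram s vs : (tv_prod s vs)^T *m G *m tv_prod s vs = G.
Proof.
suff e : (tv_prod s vs)^T *m G = G *m tv_prodV s vs.
  by rewrite e -mulmxA tv_prodVK mulmx1.
elim: vs => [|v vs IHvs] /=; first by rewrite trmx1 mul1mx mulmx1.
by rewrite trmx_mul -mulmxA IHvs mulmxA transvection_gram mulmxA.
Qed.

Lemma tv_prod0 vs : tv_prod 0 vs = 1%:M.
Proof.
by elim: vs => //= v vs ->; rewrite /transvection scale0r addr0 mulmx1.
Qed.

Lemma tv_prodV0 vs : tv_prodV 0 vs = 1%:M.
Proof.
by elim: vs => //= v vs ->; rewrite /transvection oppr0 scale0r addr0 mulmx1.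
Qed.

Lemma polymx_transvection (e : k -> k) v : polyfn (@line_coord k) e ->
  polymx (@line_coord k) (fun s => transvection (e s) v).
Proof.
by move=> e_poly; apply: polymxD; [|apply: polymxZ => //]; apply: polymx_const.
Qed.

Lemma polymx_tv_prod vs : polymx (@line_coord k) (tv_prod^~ vs).
Proof.
elim: vs => [|v vs IHvs]; first exact: polymx_const.
apply: polymxM => //; apply: polymx_transvection; exact: (polyfn_coord _ tt).
Qed.

Lemma polymx_tv_prodV vs : polymx (@line_coord k) (tv_prodV^~ vs).
Proof.
elim: vs => [|v vs IHvs]; first exact: polymx_const.
apply: polymxM => //; apply: polymx_transvection; apply: polyfnN.
exact: (polyfn_coord _ tt).
Qed.

Lemma rows_nonzero_point (z1 z2 : 'rV[k]_n) : z1 != 0 -> z2 != 0 ->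
  exists v : 'cV_n, z1 *m v != 0 /\ z2 *m v != 0.
Proof.
move=> z10 z20; have nz (z : 'rV[k]_n) : z != 0 -> exists v : 'cV_n, z *m v != 0.
  move=> z0; have /rV0Pn[j zj] := z0; exists (delta_mx j 0).
  rewrite -colE; apply: contraNneq zj => /matrixP/(_ 0 0).
  by rewrite !mxE => ->.
have [v1 v1P] := nz _ z10; have [v2 v2P] := nz _ z20.
have [e|ne] := eqVneq (z1 *m v2) 0; last by exists v2.
have [e2|ne2] := eqVneq (z2 *m v1) 0; last by exists v1.
by exists (v1 + v2); rewrite !mulmxDr e e2 addr0 add0r.
Qed.

(** A transvection changes [F^T G M] by a matrix of rank one, which can be
    chosen to raise the rank as long as it is not full. *)
Lemma general_position l (F M : 'M[k]_(n, l)) : \rank F = l -> \rank M = l ->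
  exists vs, F^T *m G *m (tv_prod 1 vs *m M) \in unitmx.
Proof.
move=> rF; have [c] := ubnP (l - \rank (F^T *m G *m M)).
elim: c M => // c IHc M; rewrite ltnS => Mc rM.
set N := F^T *m G *m M in Mc *.
have [N_unit|] := boolP (N \in unitmx).
  by exists [::]; rewrite /= mul1mx.
rewrite -row_free_unit -kermx_eq0 => kN.
pose z := nz_row (kermx N).
have z0 : z != 0 by rewrite nz_row_eq0.
have zN : z *m N = 0 by apply/sub_kermxP/nz_row_sub.
have [x x0 Nx] : exists2 x : 'cV_l, x != 0 & N *m x = 0.
  have kNT : kermx N^T != 0.
    by move: kN; rewrite !kermx_eq0 /row_free mxrank_tr.
  exists (nz_row (kermx N^T))^T; first by rewrite trmx_eq0 nz_row_eq0.
  by apply: trmx_inj; rewrite trmx_mul trmxK trmx0; apply/sub_kermxP/nz_row_sub.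
(* [v1] makes the kernel of the updated matrix part of that of [N];
   [v2] takes [x] out of it *)
have [v [v1 v2]] : exists v : 'cV_n, z *m F^T *m G *m v != 0 /\
    (M *m x)^T *m G *m v != 0.
  apply: rows_nonzero_point.
    apply: contraNneq z0 => zFG; apply/eqP/(@row_free_inj _ _ _ _ (F^T *m G)).
      by rewrite /row_free mxrankMfree ?row_free_unit // mxrank_tr rF.
    by rewrite /= mulmxA zFG mul0mx.
  apply: contraNneq x0 => xG; apply/eqP/(rank_cV_inj rM); apply: trmx_inj.
  by rewrite -[LHS](mulmxK G_unit) xG mul0mx trmx0.
pose M' := transvection 1 v *m M.
have NM' : F^T *m G *m M' = N + F^T *m G *m v *m (v^T *m G *m M).
  by rewrite /M' /transvection scale1r mulmxDl mul1mx mulmxDr !mulmxA.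
have rM' : \rank M' = l.
  apply: mx_cV_inj => y My; apply: (rank_cV_inj rM).
  have := transvectionK (-1) v; rewrite opprK => tK.
  by rewrite -[LHS]mul1mx -tK -mulmxA (mulmxA _ M) My mulmx0.
have [] := IHc M' _ rM'; last first.
  by move=> vs vsP; exists (v :: vs); rewrite /= -(mulmxA (tv_prod _ _)).
rewrite NM'; set N' := N + _.
have N'_eq0 (y : 'cV_l) : N' *m y = 0 -> v^T *m G *m M *m y = 0 /\ N *m y = 0.
  move=> N'y; suff vy : v^T *m G *m M *m y = 0.
    by split=> //; move: N'y; rewrite /N' mulmxDl -(mulmxA _ _ y) vy mulmx0 addr0.
  have := congr1 (mulmx z) N'y; rewrite mulmxDl mulmxDr mulmx0 (mulmxA z N) zN.
  rewrite mul0mx add0r !mulmxA -3!(mulmxA (z *m F^T *m G *m v)).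
  set t := v^T *m _; rewrite [_ *m v]mx11_scalar mul_scalar_mx => /eqP.
  rewrite scaler_eq0 => /orP[|/eqP //] /eqP e; case/negP: v1.
  by rewrite [_ *m v]mx11_scalar e raddf0.
have kNN' : (kermx N'^T < kermx N^T)%MS.
  rewrite /ltmx; apply/andP; split.
    apply/rV_subP => u /sub_kermxP uN'; apply/sub_kermxP.
    have [|_ Nu] := N'_eq0 u^T; first by rewrite -[N']trmxK -trmx_mul uN' trmx0.
    by rewrite -[u]trmxK -trmx_mul Nu trmx0.
  apply/negP => kNN'; have /sub_kermxP : (x^T <= kermx N'^T)%MS.
    apply: submx_trans kNN'; apply/sub_kermxP.
    by rewrite -trmx_mul Nx trmx0.
  rewrite -trmx_mul => /(congr1 trmx); rewrite trmxK trmx0 => /N'_eq0[vx _].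
  case/negP: v2; rewrite -[_ *m v]trmxK (gram_tr G_skew) mulmxA vx.
  by rewrite oppr0 trmx0.
have := rank_ltmx kNN'; rewrite !mxrank_ker !mxrank_tr.
by move: (rank_leq_row N') Mc; lia.
Qed.
End Transvections.

(** * Invariant subspaces in matrix form *)

Lemma mx_factor (k : fieldType) n p q (P : 'M[k]_(n, p)) (M : 'M[k]_(n, q)) :
  (forall x : 'cV_p, exists y : 'cV_q, P *m x = M *m y) -> exists U, P = M *m U.
Proof.
move=> PM; have /fin_all_exists[y yP] : forall j : 'I_p, exists y : 'cV_q,
  col j P = M *m y by move=> j; have [y] := PM (delta_mx j 0); rewrite -colE; exists y.
exists (\matrix_(i, j) y j i 0); apply/matrixP => i j.
have /colP/(_ i) := yP j; rewrite !mxE => ->.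
by apply: eq_bigr => t _; rewrite mxE.
Qed.

Lemma mx_form_eq0 (k : fieldType) p q (P : 'M[k]_(p, q)) :
  (forall (x : 'cV_p) (y : 'cV_q), (x^T *m P *m y) 0 0 = 0) -> P = 0.
Proof.
move=> P0; apply/matrixP => i j; have := P0 (delta_mx i 0) (delta_mx j 0).
by rewrite trmx_delta -rowE -colE !mxE.
Qed.

Lemma vspace_basis_mx (k : fieldType) n (U : {vspace 'cV[k]_n}) q : \dim U = q ->
  exists2 M : 'M[k]_(n, q), \rank M = q &
    forall w, w \in U <-> exists x : 'cV_q, w = M *m x.
Proof.
move=> <-; pose M := \matrix_(i, j) (vbasis U)`_j i 0 : 'M[k]_(n, \dim U).
have ME x : M *m x = \sum_i x i 0 *: (vbasis U)`_i.
  apply/colP => i; rewrite !mxE summxE; apply: eq_bigr => j _.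
  by rewrite !mxE mulrC.
exists M => [|w].
  apply: mx_cV_inj => x; rewrite ME => x0; apply/colP => i; rewrite mxE.
  by move/freeP: (basis_free (vbasisP U)) => /(_ (x^~ 0) x0 i).
split=> [/coord_vbasis wE|[x ->]].
  exists (\col_i coord (vbasis U) i w); rewrite ME {1}wE.
  by apply: eq_bigr => i _; rewrite mxE.
rewrite ME; apply: rpred_sum => i _; apply: rpredZ.
by apply: vbasis_mem; rewrite mem_nth // size_tuple.
Qed.

Section Forms.
Variables (k : fieldType) (n : nat) (B : {skew_symmetric 'cV[k]_n}).
Hypothesis B_nd : nondegenerate B.
Local Notation G := (gram B).

Lemma skewC v w : B v w = - B w v.
Proof. by rewrite hermC expr1 mulN1r. Qed.

Lemma gram_skew : G^T = - G.
Proof. by apply/matrixP => i j; rewrite !mxE skewC. Qed.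

Lemma gram_mx_eq0 p q (M : 'M[k]_(n, p)) (R : 'M[k]_(n, q)) :
  (M^T *m G *m R = 0) <->
  (forall (x : 'cV_p) (y : 'cV_q), B (M *m x) (R *m y) = 0).
Proof.
split=> [MR x y|MR]; last first.
  apply: mx_form_eq0 => x y; rewrite -[RHS](MR x y) gramE trmx_mul.
  by rewrite !mulmxA.
rewrite gramE trmx_mul -!mulmxA (mulmxA M^T) (mulmxA (M^T *m G)) MR mul0mx.
by rewrite mulmx0 mxE.
Qed.

Lemma orthov_stable (W : {vspace 'cV[k]_n}) (A : 'M[k]_n) :
  stable W (rho B A) -> stable (orthov B W) A.
Proof.
move=> WA x /mem_orthovP xW; apply/mem_orthovP => w wW.
by rewrite skewC -rhoP // skewC opprK xW // WA.
Qed.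

(** A complement [R] of the radical of [W] in [W] is nondegenerate. *)
Lemma invariant_adapted_basis r (A : 'I_r -> 'M[k]_n) (W : {vspace 'cV[k]_n}) :
    rho_invariant B A W ->
  exists (M : 'M_(n, isotropy_rank B W)) (R : 'M_(n, \dim W - isotropy_rank B W)),
    adapted_basis G M R /\ forall i, preserves_mx G M R (A i).
Proof.
move=> WA; set W' := orthov B W.
have [M rM MP] := vspace_basis_mx (erefl (\dim (W :&: W')%VS)).
have dimR : \dim (W :\: W')%VS = (\dim W - isotropy_rank B W)%N.
  by rewrite -(dimv_cap_compl W W') addKn.
have [R rR RP] := vspace_basis_mx dimR.
have MW x : M *m x \in W /\ M *m x \in W'.
  by apply/andP; rewrite -memv_cap; apply/MP; exists x.
have RW x : R *m x \in W.
  by apply: (subvP (diffvSl W W')); apply/RP; exists x.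
have WP w : w \in W -> exists y1 y2, w = M *m y1 + R *m y2.
  rewrite -{1}(addv_diff_cap W W') => /memv_addP[w1 /RP[y2 ->]].
  by case=> w2 /MP[y1 ->] ->; exists y1, y2; rewrite addrC.
have MW0 x w : w \in W -> B (M *m x) w = 0.
  by move=> wW; have [_ /mem_orthovP] := MW x; apply.
have W'P x : M^T *m G *m x = 0 -> R^T *m G *m x = 0 -> x \in W'.
  move=> /gram_mx_eq0 Mx /gram_mx_eq0 Rx; apply/mem_orthovP => w /WP[y1 [y2 ->]].
  have := Mx y1 1%:M; have := Rx y2 1%:M; rewrite !mulmx1 linearDr /=.
  by rewrite [B x _]skewC [B x (R *m _)]skewC => -> ->; rewrite oppr0 addr0.
have W'0 x p (P : 'M_(n, p)) : (forall y, P *m y \in W) -> x \in W' ->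
    P^T *m G *m x = 0.
  move=> PW /mem_orthovP xW; apply/gram_mx_eq0 => y z.
  have xPy : B x (P *m y) = 0 by exact: xW (PW y).
  rewrite skewC [z]mx11_scalar mul_mx_scalar linearZl_LR; apply/eqP.
  by rewrite oppr_eq0 mulf_eq0; apply/orP; right; apply/eqP.
exists M, R; split.
  split=> //.
  - by apply/gram_mx_eq0 => x y; apply: MW0; have [] := MW y.
  - by apply/gram_mx_eq0 => x y; apply: MW0.
  apply: mx_cV_inj_unit => x Rx; apply: (rank_cV_inj rR).
  apply/eqP; rewrite -memv0 -(capv_diff W W') memv_cap.
  apply/andP; split; first by apply/RP; exists x.
  apply: W'P; last by rewrite mulmxA.
  by apply/gram_mx_eq0 => y z; apply: MW0; rewrite -mulmxA.
move=> i; have [AW rAW] := WA i; have AW' := orthov_stable rAW; split.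
- apply: mx_factor => x; apply/MP; rewrite -mulmxA memv_cap.
  by have [? ?] := MW x; rewrite AW // AW'.
- have [V AR] : exists V, A i *m R = row_mx M R *m V.
    apply: mx_factor => x; rewrite -mulmxA.
    have /WP[y1 [y2 ->]] : A i *m (R *m x) \in W by apply: AW.
    by exists (col_mx y1 y2); rewrite mul_row_col.
  by exists (usubmx V), (dsubmx V); rewrite AR -{1}[V]vsubmxK mul_row_col.
move=> x Mx Rx; have Ax := AW' _ (W'P x Mx Rx).
by split; apply: W'0 => // y; have [] := MW y.
Qed.

End Forms.

(** * The parametrization *)

Section Pack.
Variables (k : fieldType) (n r : nat).

Definition pack_tuple (A : 'I_r -> 'M[k]_n) : 'rV[k]_(r * (n * n)) :=
  mxvec (\matrix_i mxvec (A i)).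

Lemma pack_tupleK A i : endo_tuple (pack_tuple A) i = A i.
Proof. by rewrite /endo_tuple /pack_tuple mxvecK rowK mxvecK. Qed.

Lemma eq_pack_tuple A A' : A =1 A' -> pack_tuple A = pack_tuple A'.
Proof. by move=> e; congr mxvec; apply/row_matrixP => i; rewrite !rowK e. Qed.

Lemma endo_tupleK x : pack_tuple (endo_tuple x) = x.
Proof.
rewrite /pack_tuple /endo_tuple -[RHS]vec_mxK; congr mxvec.
by apply/row_matrixP => i; rewrite rowK vec_mxK.
Qed.

Lemma pack_tupleE i j :
  exists i1 i2 i3, forall A, pack_tuple A i j = (A i1 : 'M_n) i2 i3.
Proof.
case/mxvec_indexP: j => i1 j; case/mxvec_indexP: j => i2 i3; exists i1, i2, i3 => A'.
by rewrite ord1 mxvecE mxE mxvecE.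
Qed.

End Pack.

Definition sympos l := {p : 'I_l * 'I_l | (p.1 <= p.2)%N}.

Lemma card_sympos l : #|{: sympos l}| = (l * l.+1)./2.
Proof.
have -> : #|{: sympos l}| = (\sum_(j < l) j.+1)%N.
  rewrite card_sig -sum1_card /=.
  rewrite -(pair_big_dep xpredT (fun i j : 'I_l => (i <= j)%N) (fun _ _ => 1%N)) /=.
  rewrite (exchange_big_dep xpredT) //=; apply: eq_bigr => j _.
  rewrite -(big_mkord (fun i => i <= j)%N (fun=> 1%N)).
  rewrite -(@big_nat_widen _ _ _ 0 j.+1 l xpredT (fun=> 1%N)) //.
  by rewrite big_const_nat iter_addn_0 mul1n subn0.
elim: l => [|l IHl]; first by rewrite big_ord0.
by rewrite big_ord_recr IHl /=; lia.
Qed.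

(** One of [(i, j)] and [(j, i)] lies in [sympos l], so the default value is
    never reached. *)
Definition symmx (k : fieldType) l (t : sympos l -> k) : 'M[k]_l :=
  \matrix_(i, j) oapp t (oapp t 0 (insub (j, i))) (insub (i, j)).

Lemma symmx_sym (k : fieldType) l (t : sympos l -> k) : (symmx t)^T = symmx t.
Proof.
apply/matrixP => i j; rewrite !mxE.
case: insubP => [u _ /= uE|/= ji]; case: insubP => [v _ /= vE|/= ij] //=.
- have [/= uP vP] := (valP u, valP v); rewrite uE vE /= in uP vP.
  congr t; apply: val_inj; rewrite /= uE vE.
  by have /val_inj -> : (i : nat) = j by lia.
Qed.

Lemma symmx_val (k : fieldType) l (t : sympos l -> k) (p : sympos l) :
  symmx t (val p).1 (val p).2 = t p.
Proof. by rewrite mxE -surjective_pairing valK. Qed.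

Lemma symmx_surj (k : fieldType) l (S : 'M[k]_l) :
  S^T = S -> symmx (fun p => S (val p).1 (val p).2) = S.
Proof.
move=> S_sym; apply/matrixP => i j; rewrite mxE.
case: insubP => [u _ /= ->|/= ji]; case: insubP => [v _ /= ->|/= ij] //=.
  by rewrite -[in RHS]S_sym [RHS]mxE.
by move: ij ji; lia.
Qed.

Section Parametrization.
Variables (k : closedFieldType) (n : nat) (G : 'M[k]_n).
Hypotheses (two_neq0 : 2%:R != 0 :> k) (G_skew : G^T = - G) (G_unit : G \in unitmx).
Variables (l m r : nat) (E : 'M[k]_(n, l)) (K : 'M[k]_(n, m)) (F : 'M[k]_(n, l)).
Hypothesis EKF : hyperbolic_frame G E K F.
Local Notation J := (K^T *m G *m K).

(** The summands are the coordinates of [Y], of the symmetric part of [Z], of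
    the middle blocks, and of [X], [X2] and [X3] for each endomorphism.  How the
    middle blocks depend on [I0] is left open: they range over a chart for the
    nondegenerate part of [W], or over all matrices when [W] is isotropic. *)
Definition param (I0 : finType) : finType :=
  ('I_m * 'I_l + sympos l + I0 + 'I_r * ('I_l * 'I_n + 'I_m * 'I_l + 'I_l * 'I_l))%type.

Lemma card_param I0 : #|param I0| =
  (m * l + (l * l.+1)./2 + #|I0| + r * (l * n + m * l + l * l))%N.
Proof. by rewrite !(card_sum, card_prod, card_ord) card_sympos. Qed.

Variables (I0 : finType) (psi : (I0 -> k) -> 'I_r -> 'M[k]_m).
Implicit Types (t : param I0 -> k) (i : 'I_r).

Definition par_Y t : 'M[k]_(m, l) := \matrix_(p, q) t (inl (inl (inl (p, q)))).
Definition par_S t : 'M[k]_l := symmx (fun p => t (inl (inl (inr p)))).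
Definition par_0 t : I0 -> k := fun p => t (inl (inr p)).
Definition par_X t i : 'M[k]_(l, n) :=
  \matrix_(p, q) t (inr (i, inl (inl (p, q)))).
Definition par_X2 t i : 'M[k]_(m, l) :=
  \matrix_(p, q) t (inr (i, inl (inr (p, q)))).
Definition par_X3 t i : 'M[k]_l := \matrix_(p, q) t (inr (i, inr (p, q))).

Definition par_E t : 'M[k]_(n, l) :=
  E + K *m par_Y t + F *m (par_S t - 2%:R^-1 *: ((par_Y t)^T *m J *m par_Y t)).

Definition par_endo t i : 'M[k]_n :=
  invariant_mx G K F (par_E t) (par_X t i) (par_X2 t i) (par_X3 t i)
    (psi (par_0 t) i).

Definition par t := pack_tuple (par_endo t).

Let quad_tr (Y : 'M[k]_(m, l)) : (Y^T *m J *m Y)^T = - (Y^T *m J *m Y).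
Proof. exact: (gram_tr (frame_gram_skew G_skew K) Y Y). Qed.

Let half2 : 2%:R^-1 + 2%:R^-1 = 1 :> k.
Proof. by rewrite -mulr2n -[LHS]mulr_natl mulfV. Qed.

Lemma par_E_gram t :
  (par_E t)^T *m G *m par_E t = 0 /\ F^T *m G *m par_E t = - 1%:M.
Proof.
have [-> FE] := frame_gram_moved G_skew EKF (par_Y t)
  (par_S t - 2%:R^-1 *: ((par_Y t)^T *m J *m par_Y t)).
split=> //; move: (quad_tr (par_Y t)); set Q := _ *m par_Y t => QT.
rewrite [(_ - _)^T]raddfB /= symmx_sym [(_ *: _)^T]linearZ /= QT scalerN opprK.
rewrite opprD [in LHS]addrACA subrr add0r -opprD -scalerDl half2 scale1r.
exact: addNr.
Qed.

Lemma par_surj Y (Z : 'M[k]_l) (t0 : I0 -> k) X X2 X3 :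
    Z - Z^T + Y^T *m J *m Y = 0 ->
  exists t, par t = pack_tuple (fun i =>
    invariant_mx G K F (E + K *m Y + F *m Z) (X i) (X2 i) (X3 i) (psi t0 i)).
Proof.
move=> YZ; pose S := Z + 2%:R^-1 *: (Y^T *m J *m Y).
have S_sym : S^T = S.
  rewrite /S trmxD [(_ *: _)^T]linearZ /= quad_tr scalerN; apply/eqP.
  rewrite eq_sym -subr_eq0 opprD addrACA opprK -scalerDl half2 scale1r.
  exact/eqP.
pose t (p : 'I_m * 'I_l + sympos l + I0 +
    'I_r * ('I_l * 'I_n + 'I_m * 'I_l + 'I_l * 'I_l)) :=
  match p with
  | inl (inl (inl (p, q))) => Y p q
  | inl (inl (inr p)) => S (val p).1 (val p).2
  | inl (inr p) => t0 p
  | inr (i, inl (inl (p, q))) => X i p q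
  | inr (i, inl (inr (p, q))) => X2 i p q
  | inr (i, inr (p, q)) => X3 i p q
  end.
exists t; rewrite /par.
have tY : par_Y t = Y by apply/matrixP => p q; rewrite mxE.
have tE : par_E t = E + K *m Y + F *m Z.
  by rewrite /par_E tY /par_S symmx_surj // /S addrK.
apply: eq_pack_tuple => i.
have tX : par_X t i = X i by apply/matrixP => p q; rewrite mxE.
have tX2 : par_X2 t i = X2 i by apply/matrixP => p q; rewrite mxE.
have tX3 : par_X3 t i = X3 i by apply/matrixP => p q; rewrite mxE.
by rewrite /par_endo tE tX tX2 tX3.
Qed.

Lemma par_poly : (forall i, polymx id (fun t0 : I0 -> k => psi t0 i)) ->
  forall j, polyfn id (fun t => par t 0 j).
Proof.
move=> psi_poly j; have [i [p [q pack_ij]]] := @pack_tupleE k n r 0 j.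
suff : polymx id (fun t => par_endo t i).
  by move=> /(_ p q); apply: polyfn_ext => t; rewrite /par pack_ij.
have coord (a b : nat) (f : 'I_a -> 'I_b -> param I0) :
    polymx id (fun t => \matrix_(p, q) t (f p q)).
  move=> p' q'; apply: (@polyfn_ext _ _ _ _ (fun t => t (f p' q'))).
    by move=> t; rewrite mxE.
  exact: polyfn_coord.
have Y_poly : polymx id par_Y by exact: coord.
have S_poly : polymx id par_S.
  move=> p' q'; have S_coord (u1 u2 : option (sympos l)) :
      polyfn id (fun t => oapp (fun u => t (inl (inl (inr u))))
        (oapp (fun u => t (inl (inl (inr u)))) 0 u1) u2).
    case: u2 => [u|] /=; first exact: polyfn_coord.
    by case: u1 => [u|] /=; [exact: polyfn_coord | exact: polyfn_const].
  apply: polyfn_ext (S_coord (insub (q', p')) (insub (p', q'))) => t.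
  by rewrite mxE.
have E_poly : polymx id par_E.
  apply: polymxD; first apply: polymxD; first exact: polymx_const.
    by apply: polymxM; first exact: polymx_const.
  apply: polymxM; first exact: polymx_const.
  apply: polymxD => //; apply: polymxN; apply: polymxZ; first exact: polyfn_const.
  apply: polymxM => //; apply: polymxM; last exact: polymx_const.
  exact: polymx_tr.
have K_poly : polymx id (fun t => moved_K G K F (par_E t)).
  apply: polymxD; first exact: polymx_const.
  apply: polymxN; apply: polymxM; first exact: polymx_const.
  apply: polymxM; last exact: polymx_const.
  by apply: polymxM; [exact: polymx_tr | exact: polymx_const].
have psi0_poly : polymx id (fun t => psi (par_0 t) i).
  move=> p' q'; have [h hE] := psi_poly i p' q'.
  apply: (@polyfn_ext _ _ _ _ (fun t => h.@[fun j => t (inl (inr (enum_val j)))])).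
    by move=> t; rewrite hE.
  by apply: polyfn_meval => j'; apply: polyfn_coord.
apply: polymxM; last exact: polymx_const.
apply: polymxD; first apply: polymxD.
- by apply: polymxM => //; apply: coord.
- apply: polymxM; last exact: polymx_tr.
  by apply: polymxD; apply: polymxM; try exact: polymx_const; apply: coord.
by apply: polymxM; [apply: polymxM | apply: polymx_tr].
Qed.

End Parametrization.

(** * The upper bound *)

Section Density.
Variables (k : closedFieldType) (n r : nat) (G : 'M[k]_n).
Hypotheses (two_neq0 : 2%:R != 0 :> k) (G_skew : G^T = - G) (G_unit : G \in unitmx).

Lemma preserves_mx_conj l a (M : 'M[k]_(n, l)) (R : 'M_(n, a)) A s vs :
    preserves_mx G M R A ->
  preserves_mx G (tv_prod G s vs *m M) (tv_prod G s vs *m R)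
    (tv_prod G s vs *m A *m tv_prodV G s vs).
Proof.
have := tv_prodVK two_neq0 G_skew s vs; have := tv_prod_gram two_neq0 G_skew s vs.
move: (tv_prod G s vs) (tv_prodV G s vs) => P Q PGP QP.
have PQ : P *m Q = 1%:M by apply: mulmx1C.
have conj p (C : 'M_(n, p)) : P *m A *m Q *m (P *m C) = P *m (A *m C).
  by rewrite -!mulmxA (mulmxA Q) QP mul1mx.
have perp p (C : 'M[k]_(n, p)) (x : 'cV_n) :
    (P *m C)^T *m G *m x = C^T *m G *m (Q *m x).
  by rewrite -[x in LHS]mul1mx -PQ -{2}PGP trmx_mul !mulmxA.
case=> [[U AM] [V [D AR]] Aperp]; split.
- by exists U; rewrite conj AM mulmxA.
- by exists V, D; rewrite conj AR mulmxDr !mulmxA.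
move=> x; rewrite !perp => Mx Rx; have := Aperp _ Mx Rx.
by rewrite -!mulmxA (mulmxA Q P) QP mul1mx.
Qed.

Lemma adapted_basis_conj l a (M : 'M[k]_(n, l)) (R : 'M_(n, a)) s vs :
  adapted_basis G M R -> adapted_basis G (tv_prod G s vs *m M) (tv_prod G s vs *m R).
Proof.
have := tv_prodVK two_neq0 G_skew s vs; have := tv_prod_gram two_neq0 G_skew s vs.
move: (tv_prod G s vs) (tv_prodV G s vs) => P Q PGP QP.
have gram p q (C : 'M[k]_(n, p)) (C' : 'M_(n, q)) :
    (P *m C)^T *m G *m (P *m C') = C^T *m G *m C'.
  by rewrite -{2}PGP trmx_mul !mulmxA.
move=> [rM MM MR RR]; split; rewrite ?gram //.
apply: mx_cV_inj => x; rewrite -mulmxA => /(congr1 (mulmx Q)).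
by rewrite (mulmxA Q P) QP mul1mx mulmx0; apply: rank_cV_inj.
Qed.

(** Conjugating by [tv_prod s vs] moves the invariant subspace into general
    position for almost all [s], and does nothing for [s = 0]. *)
Lemma general_position_dense l a (F M : 'M[k]_(n, l)) (R : 'M_(n, a))
    (x : 'rV[k]_(r * (n * n))) p : \rank F = l -> adapted_basis G M R ->
    (forall i, preserves_mx G M R (endo_tuple x i)) ->
    (forall x' M' (R' : 'M_(n, a)), F^T *m G *m M' \in unitmx ->
       adapted_basis G M' R' ->
       (forall i, preserves_mx G M' R' (endo_tuple x' i)) ->
       peval p (x' : 'rV[k]_(r * (n * n))) = 0 :> k) ->
  peval p x = 0.
Proof.
move=> rF MR xMR p0; have [rM _ _ _] := MR.
have [vs vsP] := general_position two_neq0 G_skew G_unit rF rM.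
pose y s := pack_tuple (fun i =>
  tv_prod G s vs *m endo_tuple x i *m tv_prodV G s vs).
pose e s := \det (F^T *m G *m (tv_prod G s vs *m M)).
have y0 : y 0 = x.
  rewrite -[RHS]endo_tupleK; apply: eq_pack_tuple => i.
  by rewrite tv_prod0 tv_prodV0 mul1mx mulmx1.
rewrite -y0; apply: (@polyfn_line_density k (fun s => peval p (y s)) e 1).
- apply: polyfn_meval => j; have [i [i1 [i2 pack_ij]]] := @pack_tupleE k n r 0 j.
  apply: (@polyfn_ext _ _ _ _ (fun s =>
    (tv_prod G s vs *m endo_tuple x i *m tv_prodV G s vs) i1 i2)).
    by move=> s; rewrite /y pack_ij.
  move: i1 i2 {pack_ij}; apply: polymxM; last exact: polymx_tv_prodV.
  by apply: polymxM; [exact: polymx_tv_prod | exact: polymx_const].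
- apply: polyfn_det; apply: polymxM; first exact: polymx_const.
  by apply: polymxM; [exact: polymx_tv_prod | exact: polymx_const].
- by rewrite /e -unitfE -unitmxE.
move=> s es; apply: (p0 _ (tv_prod G s vs *m M) (tv_prod G s vs *m R)).
- by rewrite unitmxE unitfE.
- exact: adapted_basis_conj.
by move=> i; rewrite pack_tupleK; apply: preserves_mx_conj.
Qed.

End Density.

Section UpperBound.
Variables (k : closedFieldType) (n r : nat) (B : {skew_symmetric 'cV[k]_n}).
Hypotheses (two_neq0 : 2%:R != 0 :> k) (B_nd : nondegenerate B).
Local Notation G := (gram B).
Let G_skew := gram_skew B.
Let G_unit := gram_unit B_nd.

Lemma frame_exists l m : (l + (m + l) = n)%N ->
  exists (E : 'M_(n, l)) (K : 'M_(n, m)) F, hyperbolic_frame G E K F.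
Proof.
move=> n_eq; have [|E [F EF]] := @hyperbolic_pairs_exist _ _ _ two_neq0 G_skew G_unit l.
  by lia.
by have [K EKF] := hyperbolic_complement two_neq0 G_skew G_unit n_eq EF; exists E, K, F.
Qed.

Lemma frame_rankF l m (E : 'M_(n, l)) (K : 'M_(n, m)) F :
  hyperbolic_frame G E K F -> \rank F = l.
Proof.
case=> [[_ _ EF] _ _ _ _]; apply: mx_cV_inj => x Fx.
by rewrite -[x]mul1mx -EF -mulmxA Fx mulmx0.
Qed.

Lemma Zeq_adapted_basis l a (A : 'I_r -> 'M[k]_n) : Zeq B l (l + a) A ->
  exists (M : 'M_(n, l)) (R : 'M_(n, a)),
    adapted_basis G M R /\ forall i, preserves_mx G M R (A i).
Proof.
case=> [[W [WA dW lW]] nZ]; have rW : isotropy_rank B W = l.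
  apply/eqP; rewrite eqn_leq lW andbT leqNgt; apply/negP => lW'.
  by apply: nZ; exists W.
by have := invariant_adapted_basis B_nd WA; rewrite rW dW addKn.
Qed.

(** The coordinates of a nondegenerate subspace, common to the [r] endomorphisms,
    and of the two diagonal blocks of each of them. *)
Definition middle_coords a b : finType :=
  ('I_b * 'I_a + 'I_r * ('I_a * 'I_a + 'I_b * 'I_b))%type.

Definition middle_endo a b (J : 'M[k]_(a + b)) (s : 'S_(a + b))
    (t : middle_coords a b -> k) (i : 'I_r) : 'M[k]_(a + b) :=
  let T := \matrix_(p, q) t (inl (p, q)) in
  let c1 := \matrix_(p, q) t (inr (i, inl (p, q))) in
  let c2 := \matrix_(p, q) t (inr (i, inr (p, q))) in
  chart1 s T *m c1 *m (chart1 s T)^T + chart2 J s T *m c2 *m (chart2 J s T)^T.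

(** The number of parameters, [E(l, a)]. *)
Definition Zdim_bound l a b := (((a + b) * l + (l * l.+1)./2 +
  (b * a + r * (a * a + b * b))) + r * (l * n + (a + b) * l + l * l))%N.

Lemma alg_independent_on_Zeq l a b (Y : 'rV[k]_(r * (n * n)) -> Prop) d
    (f g : 'I_d -> {mpoly k[r * (n * n)]}) : (l + ((a + b) + l) = n)%N ->
    incl Y (fun x => Zeq B l (l + a) (@endo_tuple k n r x)) ->
  alg_independent_on Y f g -> (d <= Zdim_bound l a b)%N.
Proof.
move=> n_eq YZ; have [E [K [F EKF]]] := frame_exists n_eq.
set J := K^T *m G *m K.
have -> : Zdim_bound l a b = #|param n l (a + b) r (middle_coords a b)|.
  by rewrite card_param !(card_sum, card_prod, card_ord).
apply: (@alg_independent_on_leq _ _ _ _ (fun s => par G E K F (middle_endo J s))).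
  move=> s; apply: par_poly => i.
  have coord (p q : nat) (h : 'I_p -> 'I_q -> middle_coords a b) :
      polymx id (fun t => \matrix_(p, q) t (h p q)).
    move=> p' q'; apply: (@polyfn_ext _ _ _ _ (fun t => t (h p' q'))).
      by move=> t; rewrite mxE.
    exact: polyfn_coord.
  have c1_poly : polymx id (fun t : middle_coords a b -> k =>
      chart1 s (\matrix_(p, q) t (inl (p, q)))).
    apply: polymxD; first exact: polymx_const.
    by apply: polymxM; [exact: polymx_const | exact: coord].
  have c2_poly : polymx id (fun t : middle_coords a b -> k =>
      chart2 J s (\matrix_(p, q) t (inl (p, q)))).
    apply: polymxM; first exact: polymx_const.
    apply: polymxD; first exact: polymx_const.
    apply: polymxN; apply: polymxM; first exact: polymx_const.
    by apply: polymx_tr; apply: coord.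
  apply: polymxD; apply: polymxM; try exact: polymx_tr;
    by apply: polymxM => //; apply: coord.
move=> p p0 x /YZ/Zeq_adapted_basis[M [R [MR xMR]]].
apply: (general_position_dense two_neq0 G_skew G_unit (frame_rankF EKF) MR xMR).
move=> x' {xMR}M {MR}R FM MR xMR.
have [Y' [Z [s [T [YZ' normal]]]]] :=
  invariant_normal_form G_skew G_unit n_eq EKF MR FM.
have nf i := normal _ (xMR i).
have /fin_all_exists[X /fin_all_exists[X2 /fin_all_exists[X3
  /fin_all_exists[c1 /fin_all_exists[c2 xE]]]]] := nf.
pose t0 (u : 'I_b * 'I_a + 'I_r * ('I_a * 'I_a + 'I_b * 'I_b)) :=
  match u with
  | inl (p, q) => T p q
  | inr (i, inl (p, q)) => c1 i p q
  | inr (i, inr (p, q)) => c2 i p q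
  end.
have [t tE] := par_surj two_neq0 G_skew E F (middle_endo J s) t0 X X2 X3 YZ'.
suff <- : par G E K F (middle_endo J s) t = x' by apply: p0.
rewrite tE -[RHS]endo_tupleK; apply: eq_pack_tuple => i.
rewrite xE /middle_endo.
have -> : \matrix_(p, q) t0 (inl (p, q)) = T by apply/matrixP => u v; rewrite mxE.
have -> : \matrix_(p, q) t0 (inr (i, inl (p, q))) = c1 i.
  by apply/matrixP => u v; rewrite mxE.
have -> : \matrix_(p, q) t0 (inr (i, inr (p, q))) = c2 i.
  by apply/matrixP => u v; rewrite mxE.
by [].
Qed.

End UpperBound.

(** * The dimension of [Z(l, l)] *)

Section Isotropic.
Variables (k : closedFieldType) (n r : nat) (B : {skew_symmetric 'cV[k]_n}).
Hypotheses (two_neq0 : 2%:R != 0 :> k) (B_nd : nondegenerate B).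
Variables (l m : nat) (E : 'M[k]_(n, l)) (K : 'M[k]_(n, m)) (F : 'M[k]_(n, l)).
Hypotheses (n_eq : (l + (m + l) = n)%N).
Hypothesis EKF : hyperbolic_frame (gram B) E K F.
Local Notation G := (gram B).
Let G_skew := gram_skew B.
Let G_unit := gram_unit B_nd.

Lemma invariant_mx_stable E' X X2 X3 C (A := invariant_mx G K F E' X X2 X3 C) :
    hyperbolic_pairs G E' F ->
  (exists U, A *m E' = E' *m U) /\ (exists U, rho B A *m E' = E' *m U).
Proof.
move=> E'F; have [_ E'K' _ _ _] := moved_frame G_skew G_unit EKF n_eq E'F.
have K'E' := gram0C G_skew E'K'; have [E'E' _ _] := E'F.
have stab (X' : 'M_(l, n)) (L : 'M_(n, l)) (C' : 'M_m) (K' := moved_K G K F E') :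
    (E' *m X' + L *m E'^T + K' *m C' *m K'^T) *m G *m E' = E' *m (X' *m G *m E').
  have := K'E'; rewrite -/K'; move: K' => K' K'E'0.
  rewrite !mulmxDl -!mulmxA (mulmxA E'^T) E'E' mulmx0 addr0.
  by rewrite (mulmxA K'^T) K'E'0 !mulmx0 addr0.
split; first by exists (X *m G *m E'); apply: stab.
exists (- ((K *m X2 + F *m X3)^T *m G *m E')).
have -> : rho B A = - ((E' *m (K *m X2 + F *m X3)^T + X^T *m E'^T +
    moved_K G K F E' *m C^T *m (moved_K G K F E')^T) *m G).
  rewrite /rho /A /invariant_mx; move: (K *m X2 + F *m X3) (moved_K _ _ _ _) => L K'.
  rewrite mulmxA mulmxK // trmx_mul G_skew mulmxN; congr (- (_ *m _)).
  rewrite !trmxD !trmx_mul !trmxK -!mulmxA; congr (_ + _); exact: addrC.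
by rewrite mulNmx stab mulmxN.
Qed.

Lemma invariant_mx_Zeq (A : 'I_r -> 'M[k]_n) E' : hyperbolic_pairs G E' F ->
    (forall i, exists X X2 X3 C, A i = invariant_mx G K F E' X X2 X3 C) ->
  Zeq B l l A.
Proof.
move=> E'F AE; have [E'E' _ E'F1] := E'F.
pose h := linfun (mulmx E' : 'cV[k]_l -> 'cV[k]_n); pose W := limg h.
have WP w : w \in W <-> exists x, w = E' *m x.
  split=> [/memv_imgP[x _ ->]|[x ->]]; first by exists x; rewrite lfunE.
  by have := memv_img h (memvf x); rewrite lfunE.
have dW : \dim W = l.
  rewrite limg_dim_eq ?dimvf /dim /= ?muln1 //; apply/eqP.
  rewrite -subv0 capfv; apply/subvP => x; rewrite memv_ker lfunE memv0 /= => /eqP E'x.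
  have /(congr1 (mulmx (F^T *m G))) := E'x.
  rewrite mulmx0 mulmxA -[F^T *m G *m E']opprK -(gram_tr G_skew) E'F1 trmx1.
  by rewrite mulNmx mul1mx => /eqP; rewrite oppr_eq0.
split; last first.
  case=> W' [_ <-]; rewrite ltnNge; apply/negP; rewrite negbK.
  exact: dimvS (capvSl _ _).
exists W; split=> //.
  move=> i; have [X [X2 [X3 [C AiE]]]] := AE i.
  have := invariant_mx_stable X X2 X3 C E'F; rewrite -AiE => -[[U AU] [U' AU']].
  split=> w /WP[x ->]; apply/WP.
    by exists (U *m x); rewrite !mulmxA AU.
  by exists (U' *m x); rewrite !mulmxA AU'.
rewrite /isotropy_rank (capv_idPl _) ?dW //.
apply/subvP => w /WP[x ->]; apply/mem_orthovP => w' /WP[y ->].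
exact: (proj1 (gram_mx_eq0 B E' E') E'E').
Qed.

Definition free_middle (t : 'I_r * ('I_m * 'I_m) -> k) (i : 'I_r) : 'M[k]_m :=
  \matrix_(p, q) t (i, (p, q)).

Local Notation I := (param n l m r ('I_r * ('I_m * 'I_m))%type).
Local Notation phi := (par G E K F free_middle).
Local Notation Z := (fun x => Zeq B l l (@endo_tuple k n r x)).
Local Notation J := (K^T *m G *m K).

Lemma phi_poly j : polyfn id (fun t => phi t 0 j).
Proof.
apply: par_poly => i p q; apply: (@polyfn_ext _ _ _ _ (fun t => t (i, (p, q)))).
  by move=> t; rewrite mxE.
exact: polyfn_coord.
Qed.

Lemma par_E_pairs (t : I -> k) : hyperbolic_pairs G (par_E G E K F t) F.
Proof.
have [E'E' FE'] := par_E_gram two_neq0 G_skew EKF t; have [[_ FF _] _ _ _ _] := EKF.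
split=> //; rewrite -[LHS]opprK -(gram_tr G_skew) FE'.
by rewrite [(- _)^T]raddfN /= trmx1 opprK.
Qed.

Lemma phi_Zeq t : Z (phi t).
Proof.
apply: (invariant_mx_Zeq (par_E_pairs t)) => i.
by rewrite pack_tupleK; do 4!eexists; reflexivity.
Qed.

(** This is [invariant_normal_form] for [a = 0]; whatever the middle blocks are,
    they are values of [free_middle]. *)
Lemma phi_dense p : (forall t, peval p (phi t) = 0) ->
  forall x, Z x -> peval p x = 0.
Proof.
move=> p0 x; rewrite -{2}[l]addn0.
move=> /(Zeq_adapted_basis B_nd)[M [R [MR xMR]]].
apply: (general_position_dense two_neq0 G_skew G_unit (frame_rankF EKF) MR xMR).
move=> x' {xMR}M {MR}R FM MR xMR.
have [Y' [Z' [s [T [YZ' normal]]]]] :=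
  @invariant_normal_form _ _ _ G_skew G_unit l 0 m E K F M R n_eq EKF MR FM.
have /fin_all_exists[C /fin_all_exists[X /fin_all_exists[X2
    /fin_all_exists[X3 xE]]]] : forall i, exists C X X2 X3, endo_tuple x' i =
    invariant_mx G K F (E + K *m Y' + F *m Z') X X2 X3 C.
  move=> i; have [X [X2 [X3 [c1 [c2 xE]]]]] := normal _ (xMR i).
  by eexists; exists X, X2, X3; exact: xE.
have [t tE] := par_surj two_neq0 G_skew E F free_middle
  (fun u => C u.1 u.2.1 u.2.2) X X2 X3 YZ'.
suff <- : phi t = x' by apply: p0.
rewrite tE -[RHS]endo_tupleK; apply: eq_pack_tuple => i; rewrite xE.
by have -> : free_middle (fun u => C u.1 u.2.1 u.2.2) i = C i
  by apply/matrixP => u v; rewrite mxE.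
Qed.

Lemma Zeq_irreducible : irreducible Z.
Proof. exact: irreducible_dense_image phi_poly phi_Zeq phi_dense. Qed.

Section Line.
Variables (i0 : 'I_r) (y : I -> k).

(** The base point is the endomorphism with eigenvalues [1] on [<E>] and [0] on
    [<K, F>]: brackets with it separate the directions that move [<E>]. *)
Definition base (u : I) : k :=
  match (u : 'I_m * 'I_l + sympos l + 'I_r * ('I_m * 'I_m) +
    'I_r * ('I_l * 'I_n + 'I_m * 'I_l + 'I_l * 'I_l))%type with
  | inr (i, inl (inl (p, q))) => if i == i0 then - F q p else 0
  | _ => 0
  end.

Definition line s (u : I) : k := base u + s * y u.

Let Y := par_Y y.
Let S := par_S y.
Let E1 := K *m Y + F *m S.
Let E2 := - (F *m (2%:R^-1 *: (Y^T *m J *m Y))).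
Let X0 i := if i == i0 then - F^T else 0.

Definition line_derivative i : 'M[k]_n := E1 *m X0 i + E *m par_X y i +
  (K *m par_X2 y i + F *m par_X3 y i) *m E^T + K *m free_middle (par_0 y) i *m K^T.

(** [C], [X2] and [X3] vanish at the base point, so the variation of [E'] and of
    [moved_K] affects their terms at second order only. *)
Lemma line_expand i a b (P : 'M_(a, n)) (Q : 'M_(n, b)) p q :
  exists2 R : k -> k, polyfn (@line_coord k) R &
    forall s, (P *m (endo_tuple (phi (line s)) i *m invmx G) *m Q) p q =
      (P *m (E *m X0 i) *m Q) p q +
      s * ((P *m line_derivative i *m Q) p q + s * R s).
Proof.
pose L := K *m par_X2 y i + F *m par_X3 y i; pose C := free_middle (par_0 y) i.
pose H s := E1 + s *: E2; pose K1 s := - (F *m ((H s)^T *m G *m K)).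
pose X := par_X y i.
pose f (A : 'M_n) := (P *m A *m Q) p q.
pose b2 s := E2 *m X0 i + H s *m X + L *m (H s)^T + K *m C *m (K1 s)^T +
  K1 s *m C *m (K + s *: K1 s)^T.
exists (fun s => f (b2 s)).
  have H_poly : polymx (@line_coord k) H.
    apply: polymxD; first exact: polymx_const.
    by apply: polymxZ; [exact: (polyfn_coord _ tt) | exact: polymx_const].
  have K1_poly : polymx (@line_coord k) K1.
    apply: polymxN; apply: polymxM; first exact: polymx_const.
    apply: polymxM; last exact: polymx_const.
    by apply: polymxM; [exact: polymx_tr | exact: polymx_const].
  suff : polymx (@line_coord k) (fun s => P *m b2 s *m Q) by apply.
  apply: polymxM; last exact: polymx_const.
  apply: polymxM; first exact: polymx_const.
  apply: polymxD; first (apply: polymxD; first (apply: polymxD; first apply: polymxD)).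
  - exact: polymx_const.
  - by apply: polymxM => //; exact: polymx_const.
  - by apply: polymxM; [exact: polymx_const | exact: polymx_tr].
  - by apply: polymxM; [exact: polymx_const | exact: polymx_tr].
  apply: polymxM; first by apply: polymxM => //; exact: polymx_const.
  apply: polymx_tr; apply: polymxD; first exact: polymx_const.
  by apply: polymxZ => //; exact: (polyfn_coord _ tt).
move=> s; rewrite pack_tupleK /par_endo /invariant_mx mulmxK //.
have [_ EK _ _ _] := EKF.
have lY : par_Y (line s) = s *: Y.
  by apply/matrixP => u v; rewrite !mxE /line add0r.
have lS : par_S (line s) = s *: S.
  rewrite /par_S /symmx; apply/matrixP => u v; rewrite !mxE /line /=.
  by case: insubP => [w _ _|_] /=; case: insubP => [z _ _|_] /=;
    rewrite ?add0r ?mulr0.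
have lE : par_E G E K F (line s) = E + s *: H s.
  rewrite /par_E lY lS [(s *: Y)^T]linearZ /= -!scalemxAl -scalemxAr.
  have sCA u (A : 'M[k]_(u, l)) : 2%:R^-1 *: (s *: A) = s *: (2%:R^-1 *: A).
    by rewrite !scalerA mulrC.
  rewrite ?sCA mulmxBr -!scalemxAr -addrA /H /E1 /E2.
  by rewrite !scalerDr !scalerN -!scalemxAr sCA !addrA.
have lK : moved_K G K F (E + s *: H s) = K + s *: K1 s.
  rewrite /moved_K trmxD [(s *: _)^T]linearZ /= !mulmxDl EK add0r -!scalemxAl.
  by rewrite -scalemxAr scalerN.
have lX : par_X (line s) i = X0 i + s *: X.
  apply/matrixP => u v; rewrite !mxE /line /= /X0; congr (_ + _).
  by case: eqP => _; rewrite !mxE.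
have lX2 : par_X2 (line s) i = s *: par_X2 y i.
  by apply/matrixP => u v; rewrite !mxE /line add0r.
have lX3 : par_X3 (line s) i = s *: par_X3 y i.
  by apply/matrixP => u v; rewrite !mxE /line add0r.
have lC : free_middle (par_0 (line s)) i = s *: C.
  by apply/matrixP => u v; rewrite !mxE /par_0 /line add0r.
rewrite lE lK lX lX2 lX3 lC -/(f _) -/(f (E *m X0 i)) -/(f (line_derivative i)).
have fD A1 A2 : f (A1 + A2) = f A1 + f A2.
  by rewrite /f mulmxDr mulmxDl mxE.
have fZ c A1 : f (c *: A1) = c * f A1.
  by rewrite /f -scalemxAr -scalemxAl mxE.
have e1 : f ((E + s *: H s) *m (X0 i + s *: X)) =
    f (E *m X0 i) + s * (f (E1 *m X0 i) + s * f (E2 *m X0 i) + f (E *m X) +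
                         s * f (H s *m X)).
  rewrite mulmxDl !mulmxDr -!scalemxAl -!scalemxAr {1}/H mulmxDl -scalemxAl.
  by rewrite !(fD, fZ); ring.
have e2 : f ((K *m (s *: par_X2 y i) + F *m (s *: par_X3 y i)) *m (E + s *: H s)^T) =
    s * (f (L *m E^T) + s * f (L *m (H s)^T)).
  rewrite -!scalemxAr -scalerDr -/L trmxD [(s *: _)^T]linearZ /= -scalemxAl.
  by rewrite mulmxDr -scalemxAr !(fD, fZ).
have e3 : f ((K + s *: K1 s) *m (s *: C) *m (K + s *: K1 s)^T) =
    s * (f (K *m C *m K^T) + s * f (K *m C *m (K1 s)^T) +
         s * f (K1 s *m C *m (K + s *: K1 s)^T)).
  rewrite -scalemxAr -scalemxAl fZ; congr (_ * _).
  rewrite !mulmxDl -!scalemxAl fD fZ; congr (_ + _).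
  by rewrite trmxD [(s *: _)^T]linearZ /= mulmxDr -scalemxAr fD fZ.
rewrite !fD e1 e2 e3 -/L -/C -/X; ring.
Qed.

(** On either side, the vectors of the dual frame that single out the component
    of the tensor in which the parameter [u] appears to first order. *)
Definition coord_left (u : I) : 'rV[k]_n :=
  match (u : 'I_m * 'I_l + sympos l + 'I_r * ('I_m * 'I_m) +
    'I_r * ('I_l * 'I_n + 'I_m * 'I_l + 'I_l * 'I_l))%type with
  | inl (inl (inl (p, q))) => row p (invmx J *m (K^T *m G))
  | inl (inl (inr v)) => row (val v).1 (E^T *m G)
  | inl (inr (i, (p, q))) => row p (invmx J *m (K^T *m G))
  | inr (i, inl (inl (p, q))) => row p (- (F^T *m G))
  | inr (i, inl (inr (p, q))) => row p (invmx J *m (K^T *m G))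
  | inr (i, inr (p, q)) => row p (E^T *m G)
  end.

Definition coord_right (u : I) : 'cV[k]_n :=
  match (u : 'I_m * 'I_l + sympos l + 'I_r * ('I_m * 'I_m) +
    'I_r * ('I_l * 'I_n + 'I_m * 'I_l + 'I_l * 'I_l))%type with
  | inl (inl (inl (p, q))) => col q (G *m E)
  | inl (inl (inr v)) => col (val v).2 (G *m E)
  | inl (inr (i, (p, q))) => col q (G *m K *m invmx J)
  | inr (i, inl (inl (p, q))) => col q 1%:M
  | inr (i, inl (inr (p, q))) => col q (G *m F)
  | inr (i, inr (p, q)) => col q (G *m F)
  end.

Definition coord_endo (u : I) : 'I_r :=
  match (u : 'I_m * 'I_l + sympos l + 'I_r * ('I_m * 'I_m) +
    'I_r * ('I_l * 'I_n + 'I_m * 'I_l + 'I_l * 'I_l))%type with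
  | inl (inl _) => i0
  | inl (inr (i, _)) => i
  | inr (i, _) => i
  end.

Lemma line_derivative_coord u :
  (coord_left u *m line_derivative (coord_endo u) *m coord_right u) 0 0 = y u.
Proof.
have [[EE FF EF] EK FK J_unit _] := EKF.
have FE := frame_gramFE G_skew EKF.
have KE := gram0C G_skew EK; have KF := gram0C G_skew FK.
have rowcol a b (P : 'M_(a, n)) (D : 'M_n) (Q : 'M_(n, b)) p q :
    (row p P *m D *m col q Q) 0 0 = (P *m D *m Q) p q.
  by rewrite -!row_mul colE mulmxA -colE !mxE.
have leftK i : K^T *m G *m line_derivative i =
    J *m (Y *m X0 i + par_X2 y i *m E^T + free_middle (par_0 y) i *m K^T).
  rewrite /line_derivative /E1 !mulmxDl !mulmxDr !mulmxA KE KF !mul0mx.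
  by rewrite !addr0.
have leftE i : E^T *m G *m line_derivative i = S *m X0 i + par_X3 y i *m E^T.
  rewrite /line_derivative /E1 !mulmxDl !mulmxDr !mulmxA EK EE EF !mul0mx !mul1mx.
  by rewrite !addr0 !add0r.
have leftF i : - (F^T *m G) *m line_derivative i = par_X y i.
  rewrite mulNmx /line_derivative /E1 !mulmxDl !mulmxDr !mulmxA FE FK FF !mul0mx.
  by rewrite !addr0 !add0r mulNmx mul1mx opprK.
have X0E i : i = i0 -> X0 i *m (G *m E) = 1%:M.
  by move=> ->; rewrite /X0 eqxx mulNmx mulmxA FE opprK.
have X0F i : X0 i *m (G *m F) = 0.
  by rewrite /X0; case: eqP => _; rewrite ?mul0mx // mulNmx mulmxA FF oppr0.
have X0K i : X0 i *m (G *m K) = 0.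
  by rewrite /X0; case: eqP => _; rewrite ?mul0mx // mulNmx mulmxA FK oppr0.
case: u => [[[[p q]|v]|[i [p q]]]|[i [[[p q]|[p q]]|[p q]]]] /=; rewrite rowcol.
- rewrite -(mulmxA (invmx J)) leftK mulKmx // !mulmxDl -!mulmxA X0E // mulmx1.
  by rewrite !(mulmxA _^T G) EE KE !mulmx0 !addr0 mxE.
- rewrite leftE mulmxDl -!mulmxA X0E // mulmx1 (mulmxA _^T G) EE mulmx0 addr0.
  exact: symmx_val.
- rewrite -(mulmxA (invmx J)) leftK mulKmx // (mulmxA _ (G *m K)) !mulmxDl.
  rewrite -!(mulmxA _ _ (G *m K)) X0K !(mulmxA _^T G) EK !mulmx0 !mul0mx.
  rewrite !add0r mulmxK //.
  by rewrite mxE.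
- by rewrite leftF mulmx1 mxE.
- rewrite -(mulmxA (invmx J)) leftK mulKmx // !mulmxDl -!mulmxA X0F // mulmx0.
  by rewrite !(mulmxA _^T G) EF KF mulmx1 mulmx0 addr0 add0r mxE.
rewrite leftE mulmxDl -!mulmxA X0F // mulmx0 (mulmxA _^T G) EF mulmx1 add0r.
by rewrite mxE.
Qed.

End Line.

Lemma coord_mpoly N (h : 'rV[k]_N -> k) :
    polyfn (fun (x : 'rV[k]_N) (i : 'I_N) => x 0 i) h ->
  exists f : {mpoly k[N]}, forall x, peval f x = h x.
Proof.
move=> [p hp]; exists (p \mPo [tuple 'X_(enum_val i) | i < #|'I_N|]) => x.
rewrite hp /peval comp_mpoly_meval; apply: meval_eq => i.
by rewrite tnth_map tnth_ord_tuple mevalXU.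
Qed.

Lemma Zeq_alg_independent (hr : (0 < r)%N) :
  exists f g : 'I_#|I| -> {mpoly k[r * (n * n)]}, alg_independent_on Z f g.
Proof.
pose i0 := Ordinal hr.
pose X0 i := if i == i0 then - F^T else 0 : 'M_(l, n).
pose h u (x : 'rV[k]_(r * (n * n))) :=
  (coord_left u *m (endo_tuple x (coord_endo i0 u) *m invmx G) *m coord_right u) 0 0
  - (coord_left u *m (E *m X0 (coord_endo i0 u)) *m coord_right u) 0 0.
have h_mpoly (j : 'I_#|I|) : exists f : {mpoly k[r * (n * n)]},
    forall x, peval f x = h (enum_val j) x.
  apply: coord_mpoly; apply: polyfnD; last exact: polyfn_const.
  apply: polymxM; last exact: polymx_const.
  apply: polymxM; first exact: polymx_const.
  apply: polymxM; last exact: polymx_const.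
  move=> p q; apply: polyfn_ext (polyfn_coord _ (mxvec_index
    (coord_endo i0 (enum_val j)) (mxvec_index p q))) => x.
  by rewrite /endo_tuple !mxE.
have /fin_all_exists[f fE] := h_mpoly.
exists f, (fun=> 1); apply: alg_independent_on_lines => y.
pose y' u := y (enum_rank u).
exists (fun s => phi (line i0 y' s)) => [s|j]; first exact: phi_Zeq.
have [R R_poly RE] := line_expand i0 y' (coord_endo i0 (enum_val j))
  (coord_left (enum_val j)) (coord_right (enum_val j)) 0 0.
exists R => // s; rewrite fE /h RE line_derivative_coord /y' enum_valK.
by rewrite addrC addKr.
Qed.

End Isotropic.

(** * Comparison of the dimensions *)

Section Maximum.
Variables (k : closedFieldType) (n r : nat) (B : {skew_symmetric 'cV[k]_n}).
Hypotheses (two_neq0 : 2%:R != 0 :> k) (B_nd : nondegenerate B) (hr : (0 < r)%N).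

Definition Zdim l d := Zdim_bound n r l (d - l) (n - l - d).

Lemma dimZ_leq l d m : in_range n l d -> dimZ B l d r m -> (m <= Zdim l d)%N.
Proof.
move=> [d1 dn ld] [[Y [_ YZ _] [[f [g fg]] _]] _].
have n_eq : (l + (((d - l) + (n - l - d)) + l) = n)%N by lia.
rewrite -{1}(subnKC ld) in YZ.
exact: (alg_independent_on_Zeq two_neq0 B_nd n_eq YZ fg).
Qed.

Lemma dimZ_isotropic l : (0 < l)%N -> (l <= n./2)%N -> dimZ B l l r (Zdim l l).
Proof.
move=> l1 ln; have n_eq : (l + ((n - l - l) + l) = n)%N by lia.
have [E [K [F EKF]]] := frame_exists two_neq0 B_nd n_eq.
have l_range : in_range n l l by split.
have irr := Zeq_irreducible r two_neq0 B_nd n_eq EKF.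
have bound Y d f g : incl Y (fun x => Zeq B l l (@endo_tuple k n r x)) ->
    alg_independent_on Y (d := d) f g -> (d <= Zdim l l)%N.
  rewrite /Zdim subnn => YZ fg; rewrite -{2}[l]addn0 in YZ.
  exact: (@alg_independent_on_Zeq _ _ _ _ two_neq0 B_nd l 0 (n - l - l)
    _ _ _ _ n_eq YZ fg).
split; last by move=> Y d [_ YZ _] [[f [g fg]] _]; apply: bound fg.
exists (fun x => Zeq B l l (@endo_tuple k n r x)); first by split.
split=> [|d f g]; last exact: bound.
have := Zeq_alg_independent two_neq0 B_nd n_eq EKF hr.
suff -> : #|param n l (n - l - l) r ('I_r * ('I_(n - l - l) * 'I_(n - l - l)))%type|
  = Zdim l l by [].
rewrite card_param !(card_prod, card_ord) /Zdim /Zdim_bound subnn.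
by rewrite add0n !muln0 !add0n.
Qed.

Lemma max_dimZ_atP (Q : nat -> nat -> Prop) M :
    (exists l, Q l l) -> (forall l d, Q l d -> l = d) ->
    (forall l, Q l l -> [/\ 0 < l, l <= n./2 & Zdim l l = M]%N) ->
    (forall l d, in_range n l d -> ~ Q l d -> (Zdim l d < M)%N) ->
  forall l d m, max_dimZ_at B r l d m <-> Q l d /\ m = M.
Proof.
move=> [l0 Ql0] Qdiag QM Qlt.
have dimM l : Q l l -> dimZ B l l r M.
  by move=> /QM[l1 ln <-]; apply: dimZ_isotropic.
have range l : Q l l -> in_range n l l by move=> /QM[].
have leM l d m : in_range n l d -> dimZ B l d r m -> (m <= M)%N.
  move=> ld dm; have [Qld|nQ] := Classical_Prop.classic (Q l d).
    have e := Qdiag _ _ Qld; rewrite -e in Qld ld dm.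
    by have [_ _ <-] := QM _ Qld; apply: dimZ_leq.
  by apply: leq_trans (dimZ_leq ld dm) (ltnW (Qlt _ _ ld nQ)).
move=> l d m; split=> [[ld dm max]|[Qld ->]].
  have Mm : (M <= m)%N by apply: max (range _ Ql0) (dimM _ Ql0).
  split; last by apply/eqP; rewrite eqn_leq Mm (leM _ _ _ ld dm).
  have [//|nQ] := Classical_Prop.classic (Q l d).
  by have := leq_trans Mm (dimZ_leq ld dm); rewrite leqNgt Qlt.
have e := Qdiag _ _ Qld; rewrite -e in Qld *.
by split; [exact: range | exact: dimM | exact: leM].
Qed.

End Maximum.

(** A nondegenerate part of [W] of dimension [a] costs [(2 r - 1) a b]
    parameters: [2 r a b] entries of the endomorphisms vanish, and the choice of
    that part adds only [a b]. *)
Lemma Zdim_split n r l a b : (Zdim_bound n r l a b + 2 * r * (a * b) =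
  Zdim_bound n r l 0 (a + b) + a * b)%N.
Proof. by rewrite /Zdim_bound; move: (_./2) => t; nia. Qed.

Lemma Zdim_le_isotropic n r l d : (0 < r)%N -> in_range n l d ->
  (Zdim n r l d <= Zdim_bound n r l 0 (n - l.*2))%N.
Proof.
move=> r0 [d1 dn ld]; have e : ((d - l) + (n - l - d) = n - l.*2)%N by lia.
have := Zdim_split n r l (d - l) (n - l - d); rewrite e -/(Zdim n r l d).
move: ((d - l) * _)%N => ab; nia.
Qed.

(** Twice the difference of the two sides is
    [(l - 1) ((2 r - 1) (4 h - 3 l - 3) - 1)], where [4 h - 3 l - 3 >= h - 3]. *)
Lemma isotropic_lt_line h r l : (0 < r)%N -> (1 < l <= h)%N -> h != 2 -> h != 3 ->
    ~ (h = 4 /\ r = 1)%N ->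
  (Zdim_bound h.*2 r l 0 (h.*2 - l.*2) < Zdim_bound h.*2 r 1 0 (h.*2 - 2))%N.
Proof.
move=> r0 /andP[l1 lh] h2 h3 h4.
have [l' l'E] : exists l', l = l'.+2 by exists (l - 2)%N; lia.
have [e eE] : exists e, h = (l'.+2 + e)%N by exists (h - l)%N; lia.
have [r' r'E] : exists r', r = r'.+1 by exists r.-1; lia.
have [q qE] : exists q, (l' + 4 * e = q.+1)%N by exists (l' + 4 * e - 1)%N; lia.
have qr : (1 < (2 * r' + 1) * q)%N.
  have [q2|q1] : (2 <= q \/ q = 1 /\ 0 < r')%N by lia.
    nia.
  nia.
rewrite /Zdim_bound; have t2 : ((l * l.+1)./2 * 2 = l * l.+1)%N.
  by rewrite muln2 halfK oddM /=; case: (odd l) => /=; rewrite ?subn0.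
move: (l * l.+1)./2 t2 => t t2.
have -> : (h.*2 - l.*2 = e.*2)%N by lia.
have -> : (h.*2 - 2 = (l'.+1 + e).*2)%N by lia.
rewrite l'E in t2 *; rewrite eE r'E -!muln2 /=.
have qq : (l'.+1 * (2 * r' + 1) * (l' + 4 * e) = l'.+1 * (2 * r' + 1) * q.+1)%N.
  by rewrite qE.
have pos : (l'.+1 * 2 <= l'.+1 * ((2 * r' + 1) * q))%N by rewrite leq_mul2l qr orbT.
clear - t2 qq pos; lia.
Qed.

Lemma Zdim_lt_line h r l d : (0 < r)%N -> h != 2 -> h != 3 ->
    ~ (h = 4 /\ r = 1)%N -> in_range h.*2 l d -> ~ (l = 1 /\ d = 1)%N ->
  (Zdim h.*2 r l d < Zdim h.*2 r 1 1)%N.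
Proof.
move=> r0 h2 h3 h4 ld ld1; have [d1 dn ld'] := ld.
have -> : Zdim h.*2 r 1 1 = Zdim_bound h.*2 r 1 0 (h.*2 - 2).
  by rewrite /Zdim subnn -subnDA.
have dh : (d <= h)%N by rewrite half_double in dn; exact: dn.
have [l1|] := ltnP 1 l.
  apply: leq_ltn_trans (Zdim_le_isotropic r0 ld) (isotropic_lt_line r0 _ h2 h3 h4).
  by rewrite l1 (leq_trans ld').
rewrite leq_eqVlt => /orP[/eqP l1|].
  have dpos : (0 < (d - 1) * (h.*2 - 1 - d))%N by rewrite muln_gt0; lia.
  have := Zdim_split h.*2 r 1 (d - 1) (h.*2 - 1 - d).
  have -> : (d - 1 + (h.*2 - 1 - d) = h.*2 - 2)%N by lia.
  rewrite l1 -/(Zdim h.*2 r 1 d); move: (_ * (_ - _))%N dpos => ab ab0; nia.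
rewrite ltnS leqn0 => /eqP l0.
have dpos : (h.*2 - 1 <= d * (h.*2 - d))%N.
  have [d' dE] : exists d', d = d'.+1 by exists d.-1; lia.
  have [e eE] : exists e, h = (d'.+1 + e)%N by exists (h - d)%N; lia.
  rewrite dE eE (_ : (d'.+1 + e).*2 - d'.+1 = d'.+1 + e.*2)%N; last by lia.
  nia.
have := Zdim_split h.*2 r 0 d (h.*2 - d).
rewrite l0 (_ : d + (h.*2 - d) = h.*2)%N; last by lia.
rewrite {1}/Zdim !subn0; move: (d * _)%N dpos => ab abh.
move: (Zdim_bound _ _ 0 d _) => z.
have [h' hE] : exists h', h = h'.+1 by exists h.-1; lia.
have [r' r'E] : exists r', r = r'.+1 by exists r.-1; lia.
rewrite /Zdim_bound hE r'E (_ : h'.+1.*2 - 2 = h'.*2)%N; last by lia.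
rewrite hE in abh; clear - abh; rewrite -!muln2 /=.
nia.
Qed.

Theorem proposition4p13 (k : closedFieldType) (hk : 2%N \notin [pchar k])
    (n r : nat) (hn : (0 < n)%N) (hr : (0 < r)%N) (n_even : ~~ odd n)
    (B : {skew_symmetric 'cV[k]_n}) (hB : nondegenerate B) :
  [/\ n = 4%N -> forall l d m : nat,
        max_dimZ_at B r l d m <->
        [/\ l = 2%N, d = 2%N & m = (12 * r + 3)%N],
      n = 6%N -> forall l d m : nat,
        max_dimZ_at B r l d m <->
        [/\ l = 3%N, d = 3%N & m = (27 * r + 6)%N],
      n = 8%N /\ r = 1%N -> forall l d m : nat,
        max_dimZ_at B r l d m <->
        ((l = 4%N /\ d = 4%N) \/ (l = 1%N /\ d = 1%N)) /\ m = 58%N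
    & n <> 4%N -> n <> 6%N -> ~ (n = 8%N /\ r = 1%N) -> forall l d m : nat,
        max_dimZ_at B r l d m <->
        [/\ l = 1%N, d = 1%N & m = ((n - 1) ^ 2 * r + 2 * r + (n - 1))%N]].
Proof.
have two_neq0 : 2%:R != 0 :> k by move: hk; rewrite inE.
have maxP := max_dimZ_atP two_neq0 hB hr.
have single l0 M : (0 < l0)%N -> (l0 <= n./2)%N -> Zdim n r l0 l0 = M ->
    (forall l d, in_range n l d -> ~ (l = l0 /\ d = l0) -> (Zdim n r l d < M)%N) ->
    forall l d m, max_dimZ_at B r l d m <-> [/\ l = l0, d = l0 & m = M].
  move=> l1 ln e lt l d m.
  have -> : [/\ l = l0, d = l0 & m = M] <-> (l = l0 /\ d = l0) /\ m = M.
    by split=> [[-> -> ->]|[[-> ->] ->]].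
  apply: (maxP (fun l d => l = l0 /\ d = l0)) => [|l' d' [-> ->]|l' [-> _]|] //.
  by exists l0.
split.
- move=> n4; apply: single; rewrite ?n4 //.
    by rewrite /Zdim /Zdim_bound /=; lia.
  move=> l d [d1 d2 ld] nld.
  rewrite /= in d2; case: d d1 d2 ld nld => [|[|[|d]]] // _ _;
    case: l => [|[|[|l]]] // _ nld; rewrite /Zdim /Zdim_bound /=; lia.
- move=> n6; apply: single; rewrite ?n6 //.
    by rewrite /Zdim /Zdim_bound /=; lia.
  move=> l d [d1 d2 ld] nld; rewrite /= in d2.
  case: d d1 d2 ld nld => [|[|[|[|d]]]] // _ _; case: l => [|[|[|[|l]]]] // _ nld;
    rewrite /Zdim /Zdim_bound /=; lia.
- move=> [n8 r1] l d m; apply: (maxP (fun l d => l = 4 /\ d = 4 \/ l = 1 /\ d = 1)%N).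
  + by exists 1%N; right.
  + by move=> l' d' [[-> ->]|[-> ->]].
  + by move=> l' [[-> _]|[-> _]]; rewrite n8 r1.
  move=> l' d'; rewrite n8 r1 => -[d1 d2 ld]; rewrite /= in d2.
  case: d' d1 d2 ld => [|[|[|[|[|d']]]]] // _ _;
    case: l' => [|[|[|[|[|l']]]]] // _ nld; by [] || by case: nld; auto.
move=> n4 n6 n8; have [h nE] : exists h, n = h.*2 by exists n./2; rewrite even_halfK.
have lineE : Zdim n r 1 1 = ((n - 1) ^ 2 * r + 2 * r + (n - 1))%N.
  have [n' n'E] : exists n', n = n'.+2 by exists (n - 2)%N; lia.
  rewrite n'E /Zdim /Zdim_bound !subSS !subn0 -mulnn add0n /=; nia.
apply: single => //; first by lia.
move=> l d ld nld; rewrite -lineE nE; rewrite nE in ld.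
apply: Zdim_lt_line => //; lia.
Qed.
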